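(* Let $m\in\mathbb{R}$ and let $a\in C^\infty(\mathbb{R}^n\times\mathbb{R}^d)$. The following are equivalent: (1) $a$ is a polyhomogeneous symbol of order $\leq m$. (2) There exists $u\in C^\infty(\mathbb{R}^n\times\mathbb{R}^d\times\mathbb{R})$, homogeneous modulo Schwartz of order $m$ in the variables $(\xi,t)$, such that $u(x,\xi,1)=a(x,\xi)$ for all $(x,\xi)\in\mathbb{R}^n\times\mathbb{R}^d$.
   Context: Points are written $(x,\xi)\in\mathbb{R}^n\times\mathbb{R}^d$ and $(x,\xi,t)\in\mathbb{R}^n\times\mathbb{R}^d\times\mathbb{R}$; $|\cdot|$ is a norm on the relevant vector space. Symbol class: $a\in C^\infty(\mathbb{R}^n\times\mathbb{R}^d)$ is a symbol of order $m$ ($a\in S^m$) if for every compact $K\subset\mathbb{R}^n$ and all multi-indices $\alpha,\beta$ there is $C>0$ with $|\partial_x^\alpha\partial_\xi^\beta a(x,\xi)|\le C(1+|\xi|)^{m-|\beta|}$ for all $x\in K$, $\xi\in\mathbb{R}^d$, where $|\beta|=\beta_1+\dots+\beta_d$. Polyhomogeneous symbol of order $\le m$: $a\in S^m$ for which there exist smooth functions $a_j$ on $\mathbb{R}^n\times(\mathbb{R}^d\setminus\{0\})$, $j\in\mathbb{N}$, with $a_j(x,s\xi)=s^{m-j}a_j(x,\xi)$ for all $s>0$, $\xi\ne0$, such that for every integer $N\ge0$ and every smooth function $\chi$ on $\mathbb{R}^d$ that vanishes on a compact neighbourhood of $0$ and equals $1$ outside some compact set, $a-\sum_{j=0}^N\chi(\xi)\,a_j\in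 S^{m-N-1}$. Schwartz class in $(\xi,t)$: $f\in C^\infty(\mathbb{R}^n\times\mathbb{R}^{d+1})$ such that for every compact $K\subset\mathbb{R}^n$, every $k\in\mathbb{N}$ and all multi-indices $\alpha,\beta$ there is $C>0$ with $|\partial_x^\alpha\partial_{(\xi,t)}^\beta f(x,\xi,t)|\le C(1+|(\xi,t)|)^{-k}$ for all $x\in K$, $(\xi,t)\in\mathbb{R}^{d+1}$. Homogeneous modulo Schwartz of order $m$ in $(\xi,t)$: $u\in C^\infty(\mathbb{R}^n\times\mathbb{R}^d\times\mathbb{R})$ such that for every $s>0$ the function $(x,\xi,t)\mapsto u(x,s\xi,st)-s^m u(x,\xi,t)$ is Schwartz class in $(\xi,t)$. *)

(* Defs.v *)
From HB Require Import structures.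
From mathcomp Require Import all_boot all_order all_algebra.
From mathcomp Require Import complex.
From mathcomp Require Import all_classical all_reals all_analysis.

Set Implicit Arguments.
Unset Strict Implicit.
Unset Printing Implicit Defensive.

Import Order.TTheory GRing.Theory Num.Theory.
Import numFieldNormedType.Exports.

Local Open Scope classical_set_scope.
Local Open Scope ring_scope.

(* Functions are complex valued.  As R[i] carries no normed R-module
   structure, differentiation acts on real and imaginary parts. *)
Definition re_part (R : realType) (T : Type) (f : T -> R[i]) : T -> R :=
  fun p => complex.Re (f p).

Definition im_part (R : realType) (T : Type) (f : T -> R[i]) : T -> R :=
  fun p => complex.Im (f p).

Definition modulus (R : realType) (z : R[i]) : R := ComplexField.Normc.normc z.

(* In finite dimension, f is C^(k+1) iff it is differentiable and all its
   directional derivatives are C^k. *)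
Fixpoint Ck_on (R : realType) (V : normedModType R) (k : nat) (U : set V)
    (f : V -> R) : Prop :=
  match k with
  | 0%N => forall p, U p -> {for p, continuous f}
  | k'.+1 => (forall p, U p -> differentiable f p) /\
             (forall v : V, Ck_on k' U ('D_v f))
  end.

(* Meant for open U; the values of f outside U are irrelevant. *)
Definition smooth_on (R : realType) (V : normedModType R) (U : set V)
    (f : V -> R[i]) : Prop :=
  forall k, Ck_on k U (re_part f) /\ Ck_on k U (im_part f).

Definition multi_index (n : nat) := 'I_n -> nat.

Definition mi_size (n : nat) (b : multi_index n) : nat := (\sum_(i < n) b i)%N.

Definition pdx (R : realType) (n d : nat) (i : 'I_n)
    (f : 'rV[R]_n * 'rV[R]_d -> R) : 'rV[R]_n * 'rV[R]_d -> R :=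
  'D_((delta_mx 0 i, 0) : 'rV[R]_n * 'rV[R]_d) f.

Definition pdxi (R : realType) (n d : nat) (j : 'I_d)
    (f : 'rV[R]_n * 'rV[R]_d -> R) : 'rV[R]_n * 'rV[R]_d -> R :=
  'D_((0, delta_mx 0 j) : 'rV[R]_n * 'rV[R]_d) f.

Definition mpartialR (R : realType) (n d : nat)
    (alpha : multi_index n) (beta : multi_index d)
    (f : 'rV[R]_n * 'rV[R]_d -> R) : 'rV[R]_n * 'rV[R]_d -> R :=
  foldr (fun i g => iter (alpha i) (pdx i) g)
    (foldr (fun j g => iter (beta j) (pdxi j) g) f (enum 'I_d))
    (enum 'I_n).

Definition mpartial (R : realType) (n d : nat)
    (alpha : multi_index n) (beta : multi_index d)
    (f : 'rV[R]_n * 'rV[R]_d -> R[i]) : 'rV[R]_n * 'rV[R]_d -> R[i] :=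
  fun p => (mpartialR alpha beta (re_part f) p +i*
            mpartialR alpha beta (im_part f) p)%C.

(* `|xi| is the sup norm on row vectors; the class does not depend on the
   choice of a norm. *)
Definition symbol (R : realType) (n d : nat) (m : R)
    (a : 'rV[R]_n * 'rV[R]_d -> R[i]) : Prop :=
  smooth_on setT a /\
  forall (K : set 'rV[R]_n) (alpha : multi_index n) (beta : multi_index d),
    compact K ->
    exists2 C : R, 0 < C &
      forall (x : 'rV[R]_n) (xi : 'rV[R]_d), K x ->
        modulus (mpartial alpha beta a (x, xi)) <=
          C * (1 + `|xi|) `^ (m - (mi_size beta)%:R).

Definition cutoff (R : realType) (d : nat) (chi : 'rV[R]_d -> R[i]) : Prop :=
  [/\ smooth_on setT chi,
      (exists K0 : set 'rV[R]_d,
         [/\ compact K0, nbhs (0 : 'rV[R]_d) K0 & forall xi, K0 xi -> chi xi = 0]) &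
      (exists K1 : set 'rV[R]_d,
         compact K1 /\ forall xi, ~ K1 xi -> chi xi = 1)].

Definition polyhomogeneous (R : realType) (n d : nat) (m : R)
    (a : 'rV[R]_n * 'rV[R]_d -> R[i]) : Prop :=
  symbol m a /\
  exists aj : nat -> 'rV[R]_n * 'rV[R]_d -> R[i],
    [/\ (forall j, smooth_on [set p | p.2 != 0] (aj j)),
        (forall (j : nat) (x : 'rV[R]_n) (xi : 'rV[R]_d) (s : R),
           0 < s -> xi != 0 ->
           aj j (x, s *: xi) = (s `^ (m - j%:R))%:C%C * aj j (x, xi)) &
        (forall (N : nat) (chi : 'rV[R]_d -> R[i]), cutoff chi ->
           symbol (m - N%:R - 1)
             (fun p => a p - \sum_(j < N.+1) chi p.2 * aj j p))].

(* Rapid decay in the second variable; it is used with 'rV[R]_(d + 1), whose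
   elements are the pairs (xi, t). *)
Definition schwartz (R : realType) (n e : nat)
    (f : 'rV[R]_n * 'rV[R]_e -> R[i]) : Prop :=
  smooth_on setT f /\
  forall (K : set 'rV[R]_n) (k : nat)
         (alpha : multi_index n) (beta : multi_index e),
    compact K ->
    exists2 C : R, 0 < C &
      forall (x : 'rV[R]_n) (w : 'rV[R]_e), K x ->
        modulus (mpartial alpha beta f (x, w)) <= C * (1 + `|w|) ^- k.

Definition homogeneous_mod_schwartz (R : realType) (n e : nat) (m : R)
    (u : 'rV[R]_n * 'rV[R]_e -> R[i]) : Prop :=
  smooth_on setT u /\
  forall s : R, 0 < s ->
    schwartz (fun p => u (p.1, s *: p.2) - (s `^ m)%:C%C * u p).

Definition fiber_pt (R : realType) (d : nat) (xi : 'rV[R]_d) (t : R) :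
    'rV[R]_(d + 1) :=
  row_mx xi (t%:M : 'rV[R]_1).

(* Main.v *)
(** If u is homogeneous modulo Schwartz, then u(x, w) with w = (xi, t) differs by
    a rapidly decreasing function from an exactly homogeneous v, the limit of
    2^(-mk) u(x, 2^k w): consecutive terms differ by a rescaled Schwartz function,
    so all derivatives converge geometrically.  The Taylor coefficients of v in t
    at t = 0 are homogeneous of degree m - j in xi, and homogeneity of the
    t-derivatives of v bounds the Taylor remainder at t = 1: this is the expansion
    of a.

    Conversely, a Borel sum provides v, homogeneous of degree m off xi = 0, with
    prescribed Taylor coefficients a_j.  Cut off near xi = 0 it becomes homogeneous
    modulo Schwartz, the defect being compactly supported in (xi, t).  By the first
    part its slice at t = 1 has the same expansion as a, so the difference r is
    rapidly decreasing in xi; adding r(x, xi) h(t), where h is a bump function with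
    h(1) = 1, repairs the slice by a Schwartz function. *)

Require Import Defs.
From HB Require Import structures.
From mathcomp Require Import all_boot all_order all_algebra.
From mathcomp Require Import complex.
From mathcomp Require Import all_classical all_reals all_analysis.
From mathcomp Require Import zify.
From mathcomp Require Import ring lra.

Set Implicit Arguments.
Unset Strict Implicit.
Unset Printing Implicit Defensive.

Import Order.TTheory GRing.Theory Num.Theory.
Import numFieldNormedType.Exports.

Local Open Scope classical_set_scope.
Local Open Scope ring_scope.

(** * Smooth functions *)

(** Real and imaginary parts are treated separately, since differentiation is available for real
    functions. A complex cutoff chi then creates cross terms with Im chi, which are harmless because
    Im chi vanishes near 0 and outside a compact set.

    Multi-indices are replaced by words in the basis directions, on which dilations, slices and
    products with a function of t act letter by letter.

    The Borel sum is built to vanish for t^2 >= 2 |xi|^2, with |xi| Euclidean. Otherwise a cutoff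
    near xi = 0 would alter it along the whole t-axis, and the homogeneity defect could be unbounded
    in t. Taylor's formula at t = 0 is used in the region |t| <= |xi|, which is compact up to
    dilation over compact sets of x and, for |xi| >= 1, contains all t in [0, 1].

    The limit v is constructed from the dilation by 2 alone; its homogeneity under another s comes
    from the decay of the defect of that s along 2^k w.

    Both directions meet in [expansion_symbol]: the slice is compared with that of v, up to a
    rapidly decreasing error in one direction, exactly for |xi| > 2 in the other. *)

Section Differentiability.
Context {R : realType} {V : normedModType R}.
Implicit Types (f g : V -> R) (p v h : V).

Lemma differentiable_eps f p : differentiable f p ->
  forall e, 0 < e ->
    \forall h \near 0, `|f (h + p) - f p - 'd f p h| <= e * `|h|.
Proof.
move=> /diff_locallyxP [_ df] e e0.
have /funext df' : forall h, f (h + p) = f p + 'd f p h +o_(h \near 0) h by [].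
have /eqaddoP/(_ e e0) : (fun h => f (h + p)) =
   (fun h => f p + 'd f p h) +o_ 0 id by rewrite df'.
apply: filterS => h /=.
by rewrite opprD addrA.
Qed.

(** Serves where the derivative is guessed and the remainder estimated by hand: sums of series, and
    [flat] at 0. *)
Lemma eps_differentiable f p (L : {linear V -> R}) : continuous L ->
  (forall e, 0 < e -> \forall h \near 0, `|f (h + p) - f p - L h| <= e * `|h|) ->
  differentiable f p /\ forall v, 'D_v f p = L v.
Proof.
move=> cL H.
have E : f \o shift p = cst (f p) + L +o_ 0 id.
  apply/eqaddoP => e e0; have := H e e0.
  by apply: filterS => h /=; rewrite opprD addrA.
have dL : 'd f p = L :> (V -> R) by exact: diff_unique.
have df : differentiable f p by apply/diff_locallyP; rewrite dL.
by split=> // v; rewrite deriveE // dL.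
Qed.

Lemma near_eq_differentiable f g p : {near p, f =1 g} ->
  differentiable f p -> differentiable g p.
Proof.
move=> fg df; have [] // := @eps_differentiable g p ('d f p).
  exact: diff_continuous.
move=> e e0; have := differentiable_eps df e0.
have fg0 : \forall h \near 0, f (h + p) = g (h + p).
  by move: fg; rewrite (near_shift 0 p) => fg; near=> h; rewrite -(subr0 p); near: h.
apply: filterS2 fg0 => h ->; by rewrite (nbhs_singleton fg).
Unshelve. all: by end_near. Qed.

Lemma open_near (U : set V) f g p : open U -> U p ->
  (forall q, U q -> f q = g q) -> {near p, f =1 g}.
Proof. by move=> oU Up fg; apply: filterS fg _; exact: open_nbhs_nbhs. Qed.

End Differentiability.

Section CkCalculus.
Context {R : realType} {V : normedModType R}.
Implicit Types (f g : V -> R) (p v h : V) (U : set V).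

Lemma Ck_onS k U f : Ck_on k.+1 U f -> Ck_on k U f.
Proof.
elim: k f => [|k IH] f /= [df H].
  by move=> p Up; apply: differentiable_continuous; exact: df.
by split=> // v; apply: IH; exact: H.
Qed.

Lemma Ck_on_sub k U U' f : U' `<=` U -> Ck_on k U f -> Ck_on k U' f.
Proof.
move=> UU'; elim: k f => [|k IH] f /=; first by move=> H p /UU' /H.
by move=> [df H]; split=> [p /UU'|v]; [exact: df|exact: IH].
Qed.

(** The derivatives in [Ck_on] are those of f itself and only the points of evaluation are
    restricted, so that regularity can be glued from two regions. This is how cut-off functions are
    shown to be smooth. *)
Lemma Ck_onU k U U' f : Ck_on k U f -> Ck_on k U' f -> Ck_on k (U `|` U') f.
Proof.
elim: k f => [|k IH] f /=; first by move=> H H' p [/H|/H'].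
move=> [df H] [df' H']; split=> [p [/df|/df']|v] //.
by apply: IH; [exact: H|exact: H'].
Qed.

(** On an open set, equality of functions is equality of germs and passes to derivatives. The rules
    below use it to replace a derivative by a formula valid on U only. *)
Lemma Ck_on_ext k U f g : open U -> (forall q, U q -> f q = g q) ->
  Ck_on k U f -> Ck_on k U g.
Proof.
move=> oU; elim: k f g => [|k IH] f g fg /=.
  move=> H p Up; have fg' := open_near oU Up fg.
  have : g x @[x --> p] --> f p.
    by apply: cvg_trans (H p Up); apply: near_eq_cvg; exact: filterS fg'.
  by rewrite (nbhs_singleton fg').
move=> [df H]; split=> [p Up|v].
  by apply: (near_eq_differentiable (f := f)) (df p Up); exact: open_near fg.
apply: (IH ('D_v f)) => // q Uq; apply: near_eq_derive.
exact: open_near fg.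
Qed.

Lemma Ck_on_cst k U (c : R) : Ck_on k U (fun=> c).
Proof.
elim: k c => [|k IH] c /=; first by move=> p Up; exact: cst_continuous.
split=> [p Up|v]; first exact: differentiable_cst.
suff -> : 'D_v (fun _ : V => c) = fun=> 0 by exact: IH.
by apply/funext => p; rewrite derive_cst.
Qed.

Lemma Ck_onD k U f g : open U -> Ck_on k U f -> Ck_on k U g ->
  Ck_on k U (fun q => f q + g q).
Proof.
move=> oU; elim: k f g => [|k IH] f g /=.
  by move=> cf cg p Up; apply: continuousD; [exact: cf|exact: cg].
move=> [df Hf] [dg Hg]; split=> [p Up|v].
  by apply: differentiableD; [exact: df|exact: dg].
apply: (Ck_on_ext (f := fun q => 'D_v f q + 'D_v g q)) => //; last exact: IH.
by move=> q Uq; rewrite deriveD //; apply: diff_derivable; [exact: df|exact: dg].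
Qed.

Lemma Ck_onM k U f g : open U -> Ck_on k U f -> Ck_on k U g ->
  Ck_on k U (fun q => f q * g q).
Proof.
move=> oU; elim: k f g => [|k IH] f g.
  by move=> cf cg p Up; apply: continuousM; [exact: cf|exact: cg].
move=> Hf Hg; have [df Df] := Hf; have [dg Dg] := Hg; split=> [p Up|v].
  by apply: differentiableM; [exact: df|exact: dg].
apply: (Ck_on_ext (f := fun q => f q * 'D_v g q + g q * 'D_v f q)) => //.
  by move=> q Uq; rewrite deriveM //; apply: diff_derivable; [exact: df|exact: dg].
by apply: Ck_onD => //; apply: IH; (exact: Ck_onS || exact: Df || exact: Dg).
Qed.

Lemma Ck_onZ k U c f : open U -> Ck_on k U f -> Ck_on k U (fun q => c * f q).
Proof. by move=> oU Hf; apply: Ck_onM => //; exact: Ck_on_cst. Qed.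

Lemma Ck_onN k U f : open U -> Ck_on k U f -> Ck_on k U (fun q => - f q).
Proof.
move=> oU /(Ck_onZ (-1) oU); apply: Ck_on_ext => // q _.
by rewrite mulN1r.
Qed.

Lemma Ck_onB k U f g : open U -> Ck_on k U f -> Ck_on k U g ->
  Ck_on k U (fun q => f q - g q).
Proof. by move=> oU Hf Hg; apply: Ck_onD => //; exact: Ck_onN. Qed.

Lemma Ck_on_sum k U (I : Type) (r : seq I) (F : I -> V -> R) : open U ->
  (forall i, Ck_on k U (F i)) -> Ck_on k U (fun q => \sum_(i <- r) F i q).
Proof.
move=> oU HF; elim: r => [|i r IH].
  apply: (Ck_on_ext (f := fun=> 0)) => //; last exact: Ck_on_cst.
  by move=> q _; rewrite big_nil.
apply: (Ck_on_ext (f := fun q => F i q + \sum_(j <- r) F j q)) => //.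
  by move=> q _; rewrite big_cons.
exact: Ck_onD.
Qed.

Lemma Ck_onX k U f n : open U -> Ck_on k U f -> Ck_on k U (fun q => f q ^+ n).
Proof.
move=> oU Hf; elim: n => [|n IH].
  by apply: (Ck_on_ext (f := fun=> 1)) => //; exact: Ck_on_cst.
apply: (Ck_on_ext (f := fun q => f q * f q ^+ n)) => //; last exact: Ck_onM.
by move=> q _; rewrite exprS.
Qed.

Lemma Ck_onV k U f : open U -> (forall q, U q -> f q != 0) -> Ck_on k U f ->
  Ck_on k U (fun q => (f q)^-1).
Proof.
move=> oU f0; elim: k => [|k IH].
  by move=> cf p Up; apply: continuousV; [exact: f0|exact: cf].
move=> Hf; have [df Df] := Hf; split=> [p Up|v].
  by apply: differentiableV; [exact: df|exact: f0].
apply: (Ck_on_ext (f := fun q => - ((f q)^-1 * (f q)^-1 * 'D_v f q))) => //.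
  move=> q Uq; rewrite deriveV; [|exact: f0|exact/diff_derivable/df].
  by rewrite expr2 invfM scaleNr.
by apply: Ck_onN => //; do !apply: Ck_onM => //; (exact: Df || (apply: IH; exact: Ck_onS)).
Qed.

Lemma Ck_on_linear k U (L : {linear V -> R}) : continuous L -> Ck_on k U L.
Proof.
move=> cL; case: k => [|k] /=; first by move=> p _; exact: cL.
split=> [p _|v]; first exact: linear_differentiable.
suff -> : 'D_v L = fun=> L v by exact: Ck_on_cst.
by apply/funext => p; rewrite deriveE ?diff_lin //; exact: linear_differentiable.
Qed.

End CkCalculus.

Section CkComposition.
Context {R : realType} {V W : normedModType R}.

(** The two difference quotients are the same function of h, so the limits agree even where f is not
    differentiable. *)
Lemma derive_affine (f : W -> R) (A : V -> W) (v : V) (w : W) (p : V) :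
  (forall h : R, A (h *: v + p) = h *: w + A p) ->
  'D_v (f \o A) p = 'D_w f (A p).
Proof.
move=> HA; rewrite /derive; set F := (X in lim (X @ _)); set G := (X in _ = lim (X @ _)).
by suff -> : F = G by []; apply/funext => h; rewrite /F /G /= HA.
Qed.

Lemma Ck_on_affine k (U : set V) (U' : set W) (f : W -> R) (L : {linear V -> W})
    (c : W) :
  continuous L -> (forall p, U p -> U' (L p + c)) -> Ck_on k U' f ->
  Ck_on k U (fun p => f (L p + c)).
Proof.
move=> cL UU'; have dA p : differentiable (fun q => L q + c) p.
  by apply: differentiableD; [exact: linear_differentiable|exact: differentiable_cst].
elim: k f => [|k IH] f.
  move=> Hf p Up; apply: (continuous_comp (f := fun p => L p + c)).
    by apply: differentiable_continuous; exact: dA.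
  by apply: Hf; exact: UU'.
move=> [df Df]; split=> [p Up|v].
  by apply: (differentiable_comp (f := fun q => L q + c)) => //; exact/df/UU'.
rewrite [X in Ck_on k U X](_ : _ = fun p => 'D_(L v) f (L p + c)); first exact: (IH _ (Df _)).
apply/funext => p; rewrite -(@derive_affine f (fun q => L q + c) v) // => h.
by rewrite linearP addrA.
Qed.

Lemma Ck_on_comp1 k (U : set V) (U' : set R) (h : R -> R) (f : V -> R) :
  open U -> (forall p, U p -> U' (f p)) -> Ck_on k U' h -> Ck_on k U f ->
  Ck_on k U (h \o f).
Proof.
move=> oU UU'; elim: k h => [|k IH] h.
  by move=> Hh Hf p Up; apply: continuous_comp; [exact: Hf|exact/Hh/UU'].
move=> [dh Dh] Hf; have [df Df] := Hf; split=> [p Up|v].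
  by apply: differentiable_comp; [exact: df|exact/dh/UU'].
apply: (Ck_on_ext (f := fun q => ('D_1 h \o f) q * 'D_v f q)) => //.
  move=> q Uq; have dq := df q Uq; have dhq := dh _ (UU' _ Uq).
  rewrite [in RHS]deriveE; last exact: differentiable_comp.
  rewrite diff_comp // /comp [in LHS]mulrC [X in _ * X = _]deriveE // deriveE //.
  have lin1 (L : {linear R -> R}) c : c * L 1 = L c.
    by rewrite -[in RHS](mulr1 c); exact/esym/linearZ.
  exact: lin1.
by apply: Ck_onM => //; [apply: IH; [exact: Dh|exact: Ck_onS]|exact: Df].
Qed.

End CkComposition.

Definition smooth {R : realType} {V : normedModType R} (U : set V) (f : V -> R) :=
  forall k, Ck_on k U f.

Section SmoothFunctions.
Context {R : realType} {V : normedModType R}.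
Implicit Types (f g : V -> R) (p q v : V) (U : set V).

Lemma smooth_derive U f v : smooth U f -> smooth U ('D_v f).
Proof. by move=> sf k; have [_ /(_ v)] := sf k.+1. Qed.

Lemma smooth_differentiable U f p : smooth U f -> U p -> differentiable f p.
Proof. by move=> /(_ 1)[+ _]; exact. Qed.

Lemma smooth_continuous U f p : smooth U f -> U p -> {for p, continuous f}.
Proof. by move=> sf Up; apply/differentiable_continuous/(smooth_differentiable sf). Qed.

Lemma derive_open_ext U f g v : open U -> (forall q, U q -> f q = g q) ->
  forall q, U q -> 'D_v f q = 'D_v g q.
Proof. by move=> oU fg q Uq; apply: near_eq_derive; exact: open_near fg. Qed.

Lemma smoothD U f g : open U -> smooth U f -> smooth U g ->
  smooth U (fun q => f q + g q).
Proof. by move=> oU sf sg k; exact: Ck_onD. Qed.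

Lemma smoothB U f g : open U -> smooth U f -> smooth U g ->
  smooth U (fun q => f q - g q).
Proof. by move=> oU sf sg k; exact: Ck_onB. Qed.

Lemma smoothM U f g : open U -> smooth U f -> smooth U g ->
  smooth U (fun q => f q * g q).
Proof. by move=> oU sf sg k; exact: Ck_onM. Qed.

Lemma smoothZ U c f : open U -> smooth U f -> smooth U (fun q => c * f q).
Proof. by move=> oU sf k; exact: Ck_onZ. Qed.

Lemma smooth_sum U (J : Type) (r : seq J) (F : J -> V -> R) : open U ->
  (forall j, smooth U (F j)) -> smooth U (fun q => \sum_(j <- r) F j q).
Proof. by move=> oU sF k; apply: Ck_on_sum => // j; exact: sF. Qed.

Lemma smooth_sub U U' f : U' `<=` U -> smooth U f -> smooth U' f.
Proof. by move=> UU' sf k; apply: Ck_on_sub (sf k). Qed.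

Lemma smooth_onE (U : set V) (a : V -> R[i]) :
  smooth_on U a <-> smooth U (re_part a) /\ smooth U (im_part a).
Proof.
split=> [sa|[s1 s2] k]; last by split.
by split=> k; have [] := sa k.
Qed.

End SmoothFunctions.

Lemma subrBACB (V : zmodType) (a b c d : V) : a - b - (c - d) = a - c - (b - d).
Proof. by rewrite !opprB (addrC d) addrACA (addrC (- b)). Qed.

Lemma dist_le_add_half (R : realType) (e a b x : R) :
  `|a - x| < e / 2 -> `|b - x| < e / 2 -> `|a - b| <= e.
Proof.
move=> ax bx; rewrite (le_trans (ler_distD x _ _))// [in leRHS](splitr e).
by rewrite lerD// ltW// distrC.
Qed.

(** * Directional mean value theorem and symmetry of second derivatives *)

Section DirectionalMVT.
Context {R : realType} {V : normedModType R}.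
Implicit Types (f : V -> R) (p v w h : V).

Lemma MVT_dir f p v (s : R) : 0 <= s ->
  (forall t : R, 0 <= t <= s -> differentiable f (t *: v + p)) ->
  exists2 t : R, 0 <= t <= s & f (s *: v + p) - f p = s * 'D_v f (t *: v + p).
Proof.
move=> s0 df.
pose A (t : R) := t *: v + p.
have dA (t : R) : differentiable A t.
  by apply: differentiableD; [exact: differentiableZl|exact: differentiable_cst].
have dg (t : R) : 0 <= t <= s -> differentiable (f \o A) t.
  by move=> ts; apply: differentiable_comp => //; exact: df.
have [x||c] := @MVT_segment R (f \o A) (fun t => 'D_v f (A t)) 0 s s0.
- rewrite in_itv /= => /andP[x0 xs]; apply: DeriveDef.
    by apply: diff_derivable; apply: dg; rewrite !ltW.
  by apply: derive_affine => h; rewrite /A [h *: _]mulr1 scalerDl addrA.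
- apply: continuous_in_subspaceT => x; rewrite inE /= in_itv /= => xs.
  by apply: differentiable_continuous; exact: dg.
rewrite in_itv /= => cs; rewrite /A /= scale0r add0r subr0 => E.
by exists c => //; rewrite E mulrC.
Qed.

(** The mean value theorem is applied along v to q |-> f (s w + q) - f q, then along w to the
    derivative of f along v. The second difference on the left is symmetric in v and w. *)
Lemma double_difference f p v w (s : R) : 0 <= s ->
  (forall t t' : R, 0 <= t <= s -> 0 <= t' <= s ->
    differentiable f (t *: w + (t' *: v + p))) ->
  (forall t t' : R, 0 <= t <= s -> 0 <= t' <= s ->
    differentiable ('D_v f) (t *: w + (t' *: v + p))) ->
  exists t t' : R, [/\ 0 <= t <= s, 0 <= t' <= s &
    f (s *: w + (s *: v + p)) - f (s *: v + p) - (f (s *: w + p) - f p) =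
    s * s * 'D_w ('D_v f) (t *: w + (t' *: v + p))].
Proof.
move=> s0 df dvf.
have s00 : (0 : R) <= 0 <= s by rewrite lexx.
have sss : (0 : R) <= s <= s by rewrite lexx s0.
pose F q := f (s *: w + q) - f q.
have dfs t : 0 <= t <= s -> differentiable (f \o (fun q => s *: w + q)) (t *: v + p).
  move=> ts; apply: differentiable_comp; last exact: df.
  by apply: differentiableD => //; exact: differentiable_cst.
have df0 t : 0 <= t <= s -> differentiable f (t *: v + p).
  by move=> ts; have := df 0 t s00 ts; rewrite scale0r add0r.
have [t ts|t' ts' E] := @MVT_dir F p v s s0.
  by apply: differentiableB; [exact: dfs|exact: df0].
have E2 : 'D_v F (t' *: v + p) =
    'D_v f (s *: w + (t' *: v + p)) - 'D_v f (t' *: v + p).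
  rewrite deriveB; [|exact/diff_derivable/dfs|exact/diff_derivable/df0].
  by congr (_ - _); apply: derive_affine => h; rewrite addrCA.
have [t ts|t ts E3] := @MVT_dir ('D_v f) (t' *: v + p) w s s0; first exact: dvf.
by exists t, t'; split => //; rewrite -mulrA -E3 -E2 -E.
Qed.

(** Schwarz's theorem: by [double_difference] in both orders, the two mixed derivatives take a
    common value at two points close to p, and both are continuous at p. *)
Lemma derive_comm (U : set V) f p v w : open U -> U p -> Ck_on 2 U f ->
  'D_v ('D_w f) p = 'D_w ('D_v f) p.
Proof.
move=> oU Up [df Df].
have dv v' q : U q -> differentiable ('D_v' f) q by move=> Uq; exact: (Df v').1.
have cvw v' w' : {for p, continuous ('D_w' ('D_v' f))}.
  by apply: ((Df v').2 w').
suff H e : 0 < e -> `|'D_v ('D_w f) p - 'D_w ('D_v f) p| <= e.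
  by apply/eqP; rewrite -subr_eq0 -normr_le0; apply/ler_addgt0Pr => e /H; rewrite add0r.
move=> e0; have e20 : 0 < e / 2 by rewrite divr_gt0.
have near1 : \forall q \near p, `|'D_v ('D_w f) p - 'D_v ('D_w f) q| < e / 2.
  by have /cvgrPdist_lt/(_ _ e20) := cvw w v.
have near2 : \forall q \near p, `|'D_w ('D_v f) p - 'D_w ('D_v f) q| < e / 2.
  by have /cvgrPdist_lt/(_ _ e20) := cvw v w.
have Unear : nbhs p U by exact: open_nbhs_nbhs.
have : \forall q \near p, [/\ `|'D_v ('D_w f) p - 'D_v ('D_w f) q| < e / 2,
   `|'D_w ('D_v f) p - 'D_w ('D_v f) q| < e / 2 & U q].
  by apply: filterS3 near1 near2 Unear.
move=> /nbhs_ballP[r /= r0 Hr].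
(* With this s all points t w + t' v + p with t, t' in [0, s] lie in the ball of radius r; the
   summand 1 keeps the denominator positive when v = w = 0. *)
pose s := r / (`|v| + `|w| + 1) / 2.
have D0 : 0 < `|v| + `|w| + 1 by rewrite ltr_wpDl// addr_ge0.
have s0 : 0 < s by rewrite !divr_gt0.
have ball_box (t t' : R) : 0 <= t <= s -> 0 <= t' <= s -> ball p r (t *: w + (t' *: v + p)).
  move=> /andP[t0 ts] /andP[t'0 t's]; rewrite -ball_normE /ball_ /= addrA opprD addrCA.
  rewrite subrr addr0 normrN.
  apply: (@le_lt_trans _ _ (s * (`|v| + `|w| + 1))).
    rewrite (le_trans (ler_normD _ _))// !normrZ !ger0_norm//.
    rewrite !mulrDr mulr1 (addrC (s * `|v|)) -addrA lerD ?ler_wpM2r//.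
    by rewrite ler_wpDr ?ler_wpM2r// ltW.
  rewrite /s mulrAC divfK ?gt_eqF//.
  by rewrite ltr_pdivrMr// ltr_pMr// ltr1n.
have Ub (t t' : R) : 0 <= t <= s -> 0 <= t' <= s -> U (t *: w + (t' *: v + p)).
  by move=> h h'; have [] := Hr _ (ball_box t t' h h').
have [t [t' [ts ts' E]]] : exists t t' : R, [/\ 0 <= t <= s, 0 <= t' <= s &
    f (s *: w + (s *: v + p)) - f (s *: v + p) - (f (s *: w + p) - f p) =
    s * s * 'D_w ('D_v f) (t *: w + (t' *: v + p))].
  by apply: (@double_difference f p v w s (ltW s0)) => a b ha hb; [exact/df/Ub|exact/dv/Ub].
have [u' [u [us' us E']]] : exists t t' : R, [/\ 0 <= t <= s, 0 <= t' <= s &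
    f (s *: v + (s *: w + p)) - f (s *: w + p) - (f (s *: v + p) - f p) =
    s * s * 'D_v ('D_w f) (t *: v + (t' *: w + p))].
  apply: (@double_difference f p w v s (ltW s0)) => a b ha hb;
    rewrite addrCA; [exact/df/Ub|exact/dv/Ub].
have : 'D_w ('D_v f) (t *: w + (t' *: v + p)) = 'D_v ('D_w f) (u' *: v + (u *: w + p)).
  have ss0 : s * s != 0 by rewrite mulf_neq0 ?gt_eqF.
  apply: (mulfI ss0); apply: (eq_trans (esym E)); apply: (eq_trans _ E').
  by rewrite (addrCA (s *: v)); exact: subrBACB.
have [_ B2 _] := Hr _ (ball_box t t' ts ts').
have [B1 _ _] := Hr _ (ball_box u u' us us').
rewrite addrCA in B1; move=> EE; move: B2; rewrite EE => B2.
exact: dist_le_add_half B1 B2.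
Qed.

End DirectionalMVT.

Section RowNorm.
Context {R : realType}.

Lemma norm_entry k (w : 'rV[R]_k) j : `|w 0 j| <= `|w|.
Proof.
rewrite -[leRHS]/(mx_norm w) mx_normrE; apply/bigmax_geP; right => /=.
by exists (0, j).
Qed.

Lemma norm_row_le k (w : 'rV[R]_k) (r : R) : 0 <= r ->
  (forall j, `|w 0 j| <= r) -> `|w| <= r.
Proof.
move=> r0 H; rewrite -[leLHS]/(mx_norm w) mx_normrE; apply/bigmax_leP; split=> //.
by case=> i j _ /=; rewrite ord1.
Qed.

End RowNorm.

(** * Iterated derivatives along words of basis directions *)

Section Words.
Context {R : realType} {n e : nat}.
Local Notation V := ('rV[R]_n * 'rV[R]_e)%type.
Local Notation I := ('I_n + 'I_e)%type.
Implicit Types (f g : V -> R) (p q v h : V) (U : set V) (i : I) (ws : seq I).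

Definition bvec i : V :=
  match i with inl j => (delta_mx 0 j, 0) | inr j => (0, delta_mx 0 j) end.

Definition coord i v : R :=
  match i with inl j => v.1 0 j | inr j => v.2 0 j end.

(** The head of the word is the outermost derivative. Unlike multi-indices, words can be
    concatenated and renamed along a map of the directions, and they support induction on one
    derivative at a time. *)
Definition dw f ws : V -> R := foldr (fun i g => 'D_(bvec i) g) f ws.

Lemma norm_coord i v : `|coord i v| <= `|v|.
Proof.
case: i => j /=; rewrite prod_normE le_max norm_entry ?orbT//.
Qed.

Lemma coord_is_linear i : linear (coord i).
Proof. by case: i => j a u v /=; rewrite !mxE. Qed.

HB.instance Definition _ i :=
  GRing.isLinear.Build R V R _ (coord i) (coord_is_linear i).

Lemma continuous_coord i : continuous (coord i).
Proof.
move=> p; case: i => j.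
  apply: (continuous_comp (f := fst) (g := fun w : 'rV[R]_n => w 0 j)).
    exact: cvg_fst.
  exact: coord_continuous.
apply: (continuous_comp (f := snd) (g := fun w : 'rV[R]_e => w 0 j)).
  exact: cvg_snd.
exact: coord_continuous.
Qed.

Lemma vec_basis v : v = \sum_i coord i v *: bvec i.
Proof.
rewrite big_sumType /=; apply: injective_projections => /=.
  rewrite [RHS](_ : _ = fst (\sum_i v.1 0 i *: (bvec (inl i))) + fst (\sum_i v.2 0 i *: (bvec
    (inr i)))) //.
  rewrite !(big_morph fst (id1 := 0) (op1 := +%R)) //=.
  rewrite [X in _ + X]big1 => [|i _]; last by rewrite scaler0.
  by rewrite addr0 -row_sum_delta.
rewrite [RHS](_ : _ = snd (\sum_i v.1 0 i *: (bvec (inl i))) + snd (\sum_i v.2 0 i *: (bvec (inr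
  i)))) //.
rewrite !(big_morph snd (id1 := 0) (op1 := +%R)) //=.
rewrite [X in X + _]big1 => [|i _]; last by rewrite scaler0.
by rewrite add0r -row_sum_delta.
Qed.

Lemma derive_basis f p v : differentiable f p ->
  'D_v f p = \sum_i coord i v * 'D_(bvec i) f p.
Proof.
move=> df; rewrite deriveE // [in LHS](vec_basis v) linear_sum /=.
by apply: eq_bigr => i _; rewrite linearZ deriveE.
Qed.

Lemma dw_cat f s1 s2 : dw f (s1 ++ s2) = dw (dw f s2) s1.
Proof. exact: foldr_cat. Qed.

Lemma dw_rcons f ws i : dw f (rcons ws i) = dw ('D_(bvec i) f) ws.
Proof. by rewrite /dw foldr_rcons. Qed.

Lemma smooth_dw U f ws : smooth U f -> smooth U (dw f ws).
Proof. by elim: ws => //= i ws IH /IH; exact: smooth_derive. Qed.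

Lemma dw_ext U f g ws : open U -> (forall q, U q -> f q = g q) ->
  forall q, U q -> dw f ws q = dw g ws q.
Proof.
by move=> oU fg; elim: ws => //= i ws IH; exact: derive_open_ext.
Qed.

Lemma dw_comm1 U f ws i : open U -> smooth U f ->
  forall q, U q -> 'D_(bvec i) (dw f ws) q = dw ('D_(bvec i) f) ws q.
Proof.
move=> oU sf; elim: ws => //= j ws IH q Uq.
apply: eq_trans (derive_open_ext (bvec j) oU IH Uq).
exact: (derive_comm _ _ oU Uq (smooth_dw ws sf 2)).
Qed.

Lemma dw_comm U f s1 s2 : open U -> smooth U f ->
  forall q, U q -> dw (dw f s1) s2 q = dw (dw f s2) s1 q.
Proof.
move=> oU sf; elim: s2 => //= i s2 IH q Uq.
apply: eq_trans (derive_open_ext (bvec i) oU IH Uq) _.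
exact: (dw_comm1 s1 i oU (smooth_dw s2 sf) Uq).
Qed.

(** Two adjacent blocks of a word may be exchanged by [dw_comm], and such exchanges generate all
    permutations. *)
Lemma dw_perm U f s1 s2 : open U -> smooth U f -> perm_eq s1 s2 ->
  forall q, U q -> dw f s1 q = dw f s2 q.
Proof.
move=> oU sf.
pose P (s : seq I) := forall q, U q -> dw f s1 q = dw f s q.
have PC (a b c : seq I) : P (a ++ b ++ c) -> P (b ++ a ++ c).
  move=> H q /[dup] Uq /H ->; rewrite !dw_cat.
  exact: (dw_comm b a oU (smooth_dw c sf) Uq).
move=> s12; exact: (@catCA_perm_ind _ P PC s1 s2 s12).

Qed.

Lemma dwD U f g ws : open U -> smooth U f -> smooth U g ->
  forall q, U q -> dw (fun q => f q + g q) ws q = dw f ws q + dw g ws q.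
Proof.
move=> oU sf sg; elim: ws => //= i ws IH q Uq.
rewrite (derive_open_ext _ oU IH) // deriveD //.
  exact/diff_derivable/(smooth_differentiable (smooth_dw _ sf)).
exact/diff_derivable/(smooth_differentiable (smooth_dw _ sg)).
Qed.

Lemma dwZ U c f ws : open U -> smooth U f ->
  forall q, U q -> dw (fun q => c * f q) ws q = c * dw f ws q.
Proof.
move=> oU sf; elim: ws => //= i ws IH q Uq.
rewrite (derive_open_ext _ oU IH) // deriveMl //.
exact/diff_derivable/(smooth_differentiable (smooth_dw _ sf)).
Qed.

Lemma dwB U f g ws : open U -> smooth U f -> smooth U g ->
  forall q, U q -> dw (fun q => f q - g q) ws q = dw f ws q - dw g ws q.
Proof.
move=> oU sf sg q Uq; rewrite -mulN1r -(dwZ _ _ oU sg) // -(dwD _ oU sf) //.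
  by apply: (dw_ext _ oU) => // q' _; rewrite mulN1r.
exact: smoothZ.
Qed.

Lemma dw0 ws q : dw (fun=> 0) ws q = 0.
Proof.
suff -> : dw (fun=> 0) ws = fun=> 0 by [].
elim: ws => //= i ws ->; apply/funext => p; exact: derive_cst.
Qed.

Lemma dw_sum U (J : Type) (r : seq J) (F : J -> V -> R) ws : open U ->
  (forall j, smooth U (F j)) -> forall q, U q ->
  dw (fun q => \sum_(j <- r) F j q) ws q = \sum_(j <- r) dw (F j) ws q.
Proof.
move=> oU sF; elim: r => [|j r IH] q Uq.
  rewrite big_nil -[RHS](dw0 ws q); apply: (dw_ext _ oU) => // q' _.
  by rewrite big_nil.
rewrite big_cons -IH // -(dwD _ oU) //; last exact: smooth_sum.
by apply: (dw_ext _ oU) => // q' _; rewrite big_cons.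
Qed.

End Words.

(** * Series of smooth functions *)

Section GeometricTail.
Context {R : realType}.
Implicit Types (a : R^nat) (C : R) (K : nat).
Local Notation half := (2^-1 : R).

Lemma half_ge0 K : 0 <= half ^+ K.
Proof. by rewrite exprn_ge0. Qed.

Lemma half_sum_le K j : \sum_(K <= k < j) half ^+ k <= 2 * half ^+ K.
Proof.
have [jK|/ltnW] := leqP j K; first by rewrite big_geq // mulr_ge0 ?half_ge0.
move=> /subnK <-; rewrite addnC; set i := (j - K)%N.
suff -> : \sum_(K <= k < K + i) half ^+ k = 2 * half ^+ K - 2 * half ^+ (K + i).
  by rewrite gerBl mulr_ge0 ?half_ge0.
elim: i => [|i IH]; first by rewrite addn0 big_geq // subrr.
by rewrite addnS big_nat_recr ?leq_addr //= IH exprS; field.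
Qed.

Lemma geo_tail a C K : 0 <= C -> (forall k, (K <= k)%N -> `|a k| <= C * half ^+ k) ->
  cvgn (series a) /\ `|limn (series a) - series a K| <= 2 * C * half ^+ K.
Proof.
move=> C0 aC.
have ca : cvgn (series a).
  apply: normed_cvg.
  (* The bound is assumed from K on only; the added sum makes it hold for the first K terms too, for
     the comparison test. *)
  pose C' := C + \sum_(0 <= k < K) `|a k| * 2 ^+ k.
  have C'0 : 0 <= C' by rewrite addr_ge0 // sumr_ge0 // => k _; rewrite mulr_ge0 // exprn_ge0.
  have sum0 : 0 <= \sum_(0 <= k < K) `|a k| * 2 ^+ k.
    by rewrite sumr_ge0 // => k _; rewrite mulr_ge0 // exprn_ge0.
  apply: (@series_le_cvg _ _ (geometric C' half)) => [k|k|k|].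
  - exact: normr_ge0.
  - by rewrite /geometric /= mulr_ge0 ?half_ge0.
  - rewrite /geometric /=; have [Kk|kK] := leqP K k.
      by rewrite (le_trans (aC k Kk)) // ler_wpM2r ?half_ge0 // lerDl.
    rewrite exprVn ler_pdivlMr ?exprn_gt0 // ler_wpDl //.
    rewrite big_mkord (bigD1 (Ordinal kK)) //= lerDl sumr_ge0 //.
  - by apply: is_cvg_geometric_series; rewrite ger0_norm // invf_lt1 // ltr1n.
split=> //.
have H j : (K <= j)%N -> `|series a j - series a K| <= 2 * C * half ^+ K.
  move=> Kj; rewrite sub_series_geq //.
  rewrite (le_trans (ler_norm_sum _ _ _)) //.
  apply: (@le_trans _ _ (\sum_(K <= k < j) C * half ^+ k)).
    by rewrite big_nat [leRHS]big_nat ler_sum // => k /andP[Kk _]; exact: aC.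
  rewrite -mulr_sumr [2 * C]mulrC -mulrA ler_wpM2l //; exact: half_sum_le.
rewrite ler_distl; apply/andP; split.
  apply: limr_ge => //; near=> j.
  have /H : (K <= j)%N by near: j; exact: nbhs_infty_ge.
  by rewrite ler_distl => /andP[].
apply: limr_le => //; near=> j.
have /H : (K <= j)%N by near: j; exact: nbhs_infty_ge.
by rewrite ler_distl => /andP[].
Unshelve. all: by end_near. Qed.

End GeometricTail.

Lemma cvg_sumr {R : realType} {T : Type} (F : set_system T) (J : Type)
    (r : seq J) (f : J -> T -> R) (l : J -> R) : Filter F ->
  (forall j, f j x @[x --> F] --> l j) ->
  \sum_(j <- r) f j x @[x --> F] --> \sum_(j <- r) l j.
Proof.
move=> FF fl; elim: r => [|j r IH].
  rewrite big_nil; under eq_fun do rewrite big_nil; exact: cvg_cst.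
rewrite big_cons; under eq_fun do rewrite big_cons.
by apply: cvgD.
Qed.

Section SmoothSeries.
Context {R : realType} {n e : nat}.
Local Notation V := ('rV[R]_n * 'rV[R]_e)%type.
Local Notation I := ('I_n + 'I_e)%type.
Local Notation half := (2^-1 : R).
Implicit Types (g : nat -> V -> R) (p q v h : V) (U : set V) (i : I) (ws : seq I).

Definition ssum g : V -> R := fun q => limn (series (fun k => g k q)).

(** Both the constant and the starting index may depend on the point: the terms of the Borel sum are
    controlled only from an index that depends on the point and on the derivative. *)
Definition geo_bounded U g := forall p, U p -> exists C K,
  0 <= C /\ \forall q \near p, forall k, (K <= k)%N -> `|g k q| <= C * half ^+ k.

(* Split the increment of the sum: finitely many terms are differentiable, and by
   the mean value theorem the k-th term of the tail contributes at most a
   constant times |h| 2^-k. *)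
Lemma ssum_differentiable U g p : open U -> U p ->
  (forall k q, U q -> differentiable (g k) q) ->
  geo_bounded U g -> (forall i, geo_bounded U (fun k => 'D_(bvec i) (g k))) ->
  differentiable (ssum g) p /\
  forall i, 'D_(bvec i) (ssum g) p = ssum (fun k => 'D_(bvec i) (g k)) p.
Proof.
move=> oU Up dg gb dgb.
have [C0 [K0 [C0ge0 near0]]] := gb p Up.
have /choice[CK HCK] : forall i, exists CK : R * nat, 0 <= CK.1 /\
    \forall q \near p, forall k, (CK.2 <= k)%N ->
      `|'D_(bvec i) (g k) q| <= CK.1 * half ^+ k.
  by move=> i; have [C [K ?]] := dgb i p Up; exists (C, K).
pose M := \sum_i (CK i).1.
pose K1 := (K0 + \sum_i (CK i).2)%N.
have M0 : 0 <= M by rewrite sumr_ge0 // => i _; exact: (HCK i).1.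
have KK1 i : ((CK i).2 <= K1)%N.
  by rewrite /K1 (bigD1 i) //= addnCA leq_addr.
have : \forall q \near p, [/\ U q,
    forall k, (K1 <= k)%N -> `|g k q| <= C0 * half ^+ k &
    forall i k, (K1 <= k)%N -> `|'D_(bvec i) (g k) q| <= (CK i).1 * half ^+ k].
  have Unear : nbhs p U by exact: open_nbhs_nbhs.
  have nearI : \forall q \near p, forall i, forall k, (K1 <= k)%N ->
      `|'D_(bvec i) (g k) q| <= (CK i).1 * half ^+ k.
    apply: (@filter_forall V ('I_n + 'I_e)%type (fun i q => forall k, (K1 <= k)%N ->
      `|'D_(bvec i) (g k) q| <= (CK i).1 * half ^+ k) (nbhs p) _) => i.
    apply: filterS (HCK i).2 => q Hq k Kk.
    by apply: Hq; exact: leq_trans Kk.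
  apply: filterS3 Unear near0 nearI => q Uq H0 HI; split=> // k Kk.
  by apply: H0; apply: leq_trans Kk; exact: leq_addr.
move=> /nbhs_ballP[r /= r0 Hr].
have Hp := Hr p (ballxx p r0).
pose l i := ssum (fun k => 'D_(bvec i) (g k)) p.
pose Lf v := \sum_i coord i v * l i.
have Llin : linear Lf.
  move=> c u w; rewrite /Lf scaler_sumr -big_split /=; apply: eq_bigr => i _.
  by rewrite linearP /= mulrDl scalerAl.
have [L LE] : exists L : {linear V -> R}, forall v, L v = Lf v.
  pose L : {linear V -> R} := HB.pack Lf (GRing.isLinear.Build _ _ _ _ Lf Llin).
  by exists L.
have cL : continuous L.
  rewrite (_ : (L : V -> R) = Lf); last by apply/funext.
  move=> q; apply: (cvg_sumr (f := fun i v => coord i v * l i) (l := fun i => coord i q * l i))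
    => i.
  by apply: cvgMr_tmp; exact: continuous_coord.
suff H : forall eps, 0 < eps ->
    \forall h \near (0 : V), `|ssum g (h + p : V) - ssum g p - L h| <= eps * `|h|.
  have [dS DS] := eps_differentiable cL H; split=> // i.
  rewrite DS LE /Lf (bigD1 i) //= big1 => [|j ji].
    by rewrite addr0; case: i => i /=; rewrite !mxE !eqxx mul1r.
  case: i j ji => i [] j /= ji; rewrite !mxE ?mul0r //=.
    by have [E|] := eqVneq i j; rewrite ?mul0r // E eqxx in ji *.
  by have [E|] := eqVneq i j; rewrite ?mul0r // E eqxx in ji *.
move=> eps eps0.
have eps20 : 0 < eps / 2 by rewrite divr_gt0.
pose E k h := g k (h + p) - g k p - \sum_i coord i h * 'D_(bvec i) (g k) p.
have EE k h : E k h = g k (h + p) - g k p - 'd (g k) p h.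
  have dgp : differentiable (g k) p by apply: dg; have [] := Hp.
  by rewrite /E -derive_basis // deriveE.
have Eb k h : (K1 <= k)%N -> `|h| < r -> `|E k h| <= (2 * M * `|h|) * half ^+ k.
  move=> Kk hr.
  have Db q : ball p r q -> `|'D_h (g k) q| <= M * `|h| * half ^+ k.
    move=> /Hr[Uq _ Hq]; rewrite derive_basis; last exact: dg.
    rewrite (le_trans (ler_norm_sum _ _ _)) // /M !mulr_suml ler_sum // => i _.
    rewrite normrM mulrC (mulrAC _ _ (half ^+ k)) ler_pM //; first exact: Hq.
    exact: norm_coord.
  have [t|t t01 Et] := @MVT_dir R V (g k) p h 1 ler01.
    move=> /andP[t0 t1]; apply: dg; have [] // := Hr (t *: h + p).
    rewrite -ball_normE /ball_ /= opprD addrCA subrr addr0 normrN normrZ ger0_norm //.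
    by rewrite (le_lt_trans _ hr) // ler_piMl.
  rewrite scale1r mul1r in Et.
  rewrite /E Et -derive_basis; last by apply: dg; have [] := Hp.
  rewrite (le_trans (ler_normB _ _)) // [leRHS](_ : _ = M * `|h| * half ^+ k + M * `|h| * half
    ^+ k); last by ring.
  rewrite lerD // Db //; last exact: ballxx.
  move: t01 => /andP[t0 t1]; rewrite -ball_normE /ball_ /= opprD addrCA subrr addr0 normrN
    normrZ ger0_norm //.
  by rewrite (le_lt_trans _ hr) // ler_piMl.
(* By [geo_tail] the remainders E k h with k >= K sum to at most 2 (2 M |h|) 2^-K, which is to be at
   most eps / 2 |h|. *)
have [K [K1K HK]] : exists K, (K1 <= K)%N /\ 2 * (2 * M) * half ^+ K <= eps / 2.
  have : (fun k => geometric (2 * (2 * M)) half k) @ \oo --> (0 : R).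
    by apply: cvg_geometric; rewrite ger0_norm // invf_lt1 // ltr1n.
  move=> /cvgrPdist_le/(_ _ eps20) HN.
  have [N _ {}HN] := HN.
  exists (K1 + N)%N; split; first exact: leq_addr.
  have := HN (K1 + N)%N (leq_addl _ _); rewrite /= sub0r normrN; apply: le_trans.
  exact: ler_norm.
(* The other half of eps is shared among the first K terms. The induction is on the number of terms,
   with K + 1 in the denominator fixed; it is positive even for K = 0. *)
have nearK : \forall h \near (0 : V), forall k, (k < K)%N -> `|E k h| <= eps / 2 / K.+1%:R * `|h|.
  elim: {1 3}K => [|k IH]; first by near=> h.
  have dgp : differentiable (g k) p by apply: dg; have [] := Hp.
  have e0 : 0 < eps / 2 / K.+1%:R by rewrite divr_gt0.
  apply: filterS2 (differentiable_eps dgp e0) IH => h Hh IHh j; rewrite ltnS leq_eqVlt.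
  by move=> /orP[/eqP ->|/IHh //]; rewrite EE.
have nearr : \forall h \near (0 : V), `|h| < r.
  have : nbhs (0 : V) (ball (0 : V) r) by exact: nbhsx_ballx.
  by apply: filterS => h; rewrite -ball_normE /ball_ /= sub0r normrN.
apply: filterS2 nearr nearK => h hr HhK.
have bph : ball p r (h + p).
  by rewrite -ball_normE /ball_ /= opprD addrCA subrr addr0 normrN.
have [_ /(geo_tail C0ge0)[cgh _] _] := Hr _ bph.
have [_ /(geo_tail C0ge0)[cgp _] cD] := Hp.
have cD' i := (geo_tail (HCK i).1 (cD i)).1.
have ES : series (fun k => E k h) = (fun j => series (fun k => g k (h + p)) j -
     series (fun k => g k p) j - \sum_i coord i h * series (fun k => 'D_(bvec i) (g k) p) j).
  apply/funext => j; rewrite /series /= !sumrB /=; congr (_ - _).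
  by rewrite exchange_big /=; apply: eq_bigr => i _; rewrite mulr_sumr.
have -> : ssum g (h + p) - ssum g p - L h = limn (series (fun k => E k h)).
  apply/esym/cvg_lim => //; rewrite ES; apply: cvgB; first exact: cvgB.
  rewrite LE; apply: (cvg_sumr (f := fun i j => coord i h * series (fun k => 'D_(bvec i) (g k)
    p) j) (l := fun i => coord i h * l i)) => i.
  by apply: cvgMl_tmp; exact: cD'.
have MM : 0 <= 2 * M * `|h| by rewrite !mulr_ge0.
have EbK k : (K <= k)%N -> `|E k h| <= (2 * M * `|h|) * half ^+ k.
  by move=> Kk; apply: Eb => //; exact: leq_trans Kk.
have [_ T] := geo_tail MM EbK.
rewrite -(subrK (series (fun k => E k h) K) (limn _)).
rewrite (le_trans (ler_normD _ _)) // [eps]splitr mulrDl lerD //.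
  rewrite (le_trans T) // [leLHS](_ : _ = 2 * (2 * M) * half ^+ K * `|h|); last by ring.
  by rewrite ler_wpM2r.
rewrite /series /= (le_trans (ler_norm_sum _ _ _)) //.
apply: (@le_trans _ _ (\sum_(0 <= k < K) eps / 2 / K.+1%:R * `|h|)).
  by rewrite big_nat [leRHS]big_nat ler_sum // => k /andP[_ kK]; exact: HhK.
rewrite sumr_const_nat subn0 -[_ *+ K]mulr_natr mulrAC ler_wpM2r //.
by rewrite [leLHS]mulrAC ler_pdivrMr // ler_wpM2l ?ler_nat // ltW.
Unshelve. all: by end_near. Qed.

Definition geo_smooth U g :=
  (forall k, smooth U (g k)) /\ forall ws, geo_bounded U (fun k => dw (g k) ws).

Lemma geo_smooth_derive U g i : geo_smooth U g -> geo_smooth U (fun k => 'D_(bvec i) (g k)).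
Proof.
move=> [sg gb]; split=> [k|ws]; first exact/smooth_derive.
have := gb (rcons ws i); congr (geo_bounded _ _); apply/funext => k.
exact: dw_rcons.
Qed.

Lemma geo_smooth_differentiable U g p : open U -> U p -> geo_smooth U g ->
  differentiable (ssum g) p /\
  forall i, 'D_(bvec i) (ssum g) p = ssum (fun k => 'D_(bvec i) (g k)) p.
Proof.
move=> oU Up [sg gb]; apply: (ssum_differentiable oU) => //.
- by move=> k q; exact: smooth_differentiable.
- exact: (gb [::]).
- by move=> i; exact: (gb [:: i]).
Qed.

(** [geo_smooth] is stable under termwise differentiation along basis directions, so the order of
    differentiability rises by induction; other directions are combinations of these. *)
Lemma smooth_ssum U g : open U -> geo_smooth U g -> smooth U (ssum g).
Proof.
move=> oU sg k; elim: k g sg => [|k IH] g sg.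
  move=> p Up; apply: differentiable_continuous.
  exact: (geo_smooth_differentiable oU Up sg).1.
split=> [p Up|v]; first exact: (geo_smooth_differentiable oU Up sg).1.
apply: (Ck_on_ext (f := fun q => \sum_i coord i v * ssum (fun k => 'D_(bvec i) (g k)) q)) => //.
  move=> q Uq; have [dS DS] := geo_smooth_differentiable oU Uq sg.
  by rewrite derive_basis //; apply: eq_bigr => i _; rewrite DS.
by apply: Ck_on_sum => // i; apply: Ck_onZ => //; apply: IH; exact: geo_smooth_derive.
Qed.

Lemma dw_ssum U g ws : open U -> geo_smooth U g ->
  forall q, U q -> dw (ssum g) ws q = ssum (fun k => dw (g k) ws) q.
Proof.
move=> oU sg; elim/last_ind: ws g sg => [//|ws i IH] g sg q Uq.
rewrite dw_rcons (dw_ext ws oU (g := ssum (fun k => 'D_(bvec i) (g k)))) //.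
  rewrite IH //; last exact: geo_smooth_derive.
  by congr (ssum _ _); apply/funext => k; rewrite dw_rcons.
by move=> q' Uq'; exact: (geo_smooth_differentiable oU Uq' sg).2.
Qed.

End SmoothSeries.

(** * A smooth step function *)

Section SmoothStep.
Context {R : realType}.
Implicit Types (t x : R) (j k : nat).

(* The functions t^-j exp(-1/t) span a space stable under differentiation. *)
Definition flat j t : R := if 0 < t then t^-1 ^+ j * expR (- t^-1) else 0.

(** From exp x >= x^(j+2) / (j+2)! at x = 1/t. The quadratic vanishing at 0 shows that each [flat j]
    has derivative 0 there. *)
Lemma flat_le j t : 0 <= flat j t <= j.+2`!%:R * t ^+ 2.
Proof.
rewrite /flat; case: ifPn => [t0|]; last by rewrite lexx mulr_ge0 // sqr_ge0.
have x0 : 0 <= t^-1 by rewrite invr_ge0 ltW.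
rewrite mulr_ge0 ?expR_ge0 ?exprn_ge0 //=.
rewrite expRN ler_pdivrMr ?expR_gt0 // mulrAC.
have := expR_ge1Dxn j.+1 x0; set f := _.+2`!%:R => H.
have f0 : 0 < f by rewrite ltr0n fact_gt0.
have {}H : t^-1 ^+ j.+2 <= f * expR t^-1.
  rewrite mulrC -ler_pdivrMr //; apply: le_trans H.
  by rewrite lerDr.
have t20 : 0 <= t ^+ 2 by exact: sqr_ge0.
have := ler_wpM2r t20 H; apply: le_trans.
by rewrite -[j.+2]addn2 exprD -mulrA -exprMn mulVf ?gt_eqF // expr1n mulr1.
Qed.

Lemma is_derive_flat j t : is_derive t 1 (flat j) (- j%:R * flat j.+1 t + flat j.+2 t).
Proof.
have [t0|t0|<-] := ltgtP 0 t; last first.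
- rewrite /flat ltxx mulr0 addr0.
  have c0 : continuous (\0 : {linear R -> R}) by move=> x; exact: cst_continuous.
  have [df Df] : differentiable (flat j) 0 /\ forall v, 'D_v (flat j) 0 = (\0 : {linear R -> R})
    v.
    apply: eps_differentiable => // eps eps0.
    have : nbhs (0 : R) (ball (0 : R) (eps / j.+2`!%:R)).
      by apply: nbhsx_ballx; rewrite divr_gt0 // ltr0n fact_gt0.
    apply: filterS => h; rewrite -ball_normE /ball_ /= sub0r normrN => hr.
    rewrite addr0 {2}/flat ltxx !subr0.
    have /andP[f0 fh] := flat_le j h.
    rewrite ger0_norm // (le_trans fh) // -real_normK ?num_real // expr2 mulrA.
    rewrite ler_wpM2r // mulrC -ler_pdivlMr ?ltr0n ?fact_gt0 //.
    exact: ltW.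
  by apply: DeriveDef; [exact: diff_derivable|rewrite Df].
- have n0 : \near t, (fun=> 0) t = flat j t.
    have : nbhs t [set x | x < 0] by exact: lt_nbhsl.
    by apply: filterS => x /= x0; rewrite /flat ltNge ltW.
  apply: near_eq_is_derive n0 _.
  by rewrite /flat !(ltNge 0) !ltW //= mulr0 addr0; exact: is_derive_cst.
have n0 : \near t, ((fun x => x ^+ j * expR (- x)) \o (fun x => x^-1)) t = flat j t.
  have : nbhs t [set x | 0 < x] by exact: lt_nbhsr.
  by apply: filterS => x /= x0; rewrite /flat x0.
apply: near_eq_is_derive n0 _.
have tn0 : t != 0 by rewrite gt_eqF.
have d1 : is_derive (t^-1) 1 (fun x : R => x ^+ j) (j%:R * t^-1 ^+ j.-1).
  apply: DeriveDef; first exact: exprn_derivable.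
  by rewrite exp_derive scaler1.
have d2 : is_derive (t^-1) 1 (fun x : R => expR (- x)) (expR (- t^-1) * (-1)).
  exact: (@is_derive1_comp _ expR (fun x => - x)).
have d3 := is_deriveM d1 d2.
have d4 : is_derive t 1 (fun x => x^-1) (- t ^- 2 *: 1) by exact: is_deriveV.
have d5 := is_derive1_comp d3 d4.
apply: is_derive_eq d5 _.
rewrite /flat t0 /GRing.scale /= mulr1.
rewrite -exprVn; move: (t^-1) (expR _) => y E.
by case: j {d1 d3} => [|j] /=; rewrite ?exprS; ring.
Qed.

Lemma Ck_flat k j : Ck_on k setT (flat j).
Proof.
have df i t : differentiable (flat i) t by apply/derivable1_diffP; have [] := is_derive_flat i t.
elim: k j => [|k IH] j; first by move=> p _; exact: differentiable_continuous.
split=> [p _|v]; first exact: df.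
apply: (Ck_on_ext (f := fun t => v * (- j%:R * flat j.+1 t + flat j.+2 t))).
- exact: openT.
- move=> t _; rewrite deriveE //.
  have [_ <-] := is_derive_flat j t; rewrite deriveE //.
  have lin1 (L : {linear R -> R}) c : c * L 1 = L c.
    by rewrite -[in RHS](mulr1 c); exact/esym/linearZ.
  exact: lin1.
apply: Ck_onZ; first exact: openT.
apply: Ck_onD; [exact: openT| |exact: IH].
by apply: Ck_onZ; [exact: openT|exact: IH].
Qed.

(** It falls from 1 to 0 between 1 and 2. The denominator is positive because 2 - t and t - 1 are
    never both nonpositive. *)
Definition smooth_step t : R := flat 0 (2 - t) / (flat 0 (2 - t) + flat 0 (t - 1)).

Lemma flat0_gt0 t : (0 < flat 0 t) = (0 < t).
Proof. by rewrite /flat; case: ifP => // t0; rewrite ?mul1r ?expR_gt0 ?ltxx. Qed.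

Lemma flat0_le0 t : t <= 0 -> flat 0 t = 0.
Proof. by rewrite /flat ltNge => ->. Qed.

Lemma flat0_ge0 t : 0 <= flat 0 t.
Proof. by have /andP[] := flat_le 0 t. Qed.

Lemma smooth_step_den t : 0 < flat 0 (2 - t) + flat 0 (t - 1).
Proof.
have [t2|t2] := ltP t 2.
  by rewrite ltr_wpDr ?flat0_ge0 // flat0_gt0 subr_gt0.
by rewrite ltr_wpDl ?flat0_ge0 // flat0_gt0 subr_gt0 (lt_le_trans _ t2) // ltr1n.
Qed.

Lemma smooth_step1 t : t <= 1 -> smooth_step t = 1.
Proof.
move=> t1; have := smooth_step_den t; rewrite /smooth_step.
have -> : flat 0 (t - 1) = 0 by apply: flat0_le0; rewrite subr_le0.
by rewrite addr0 => H; rewrite divff // gt_eqF.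
Qed.

Lemma smooth_step0 t : 2 <= t -> smooth_step t = 0.
Proof. by move=> t2; rewrite /smooth_step flat0_le0 ?mul0r // subr_le0. Qed.

Lemma smooth_smooth_step : smooth setT smooth_step.
Proof.
move=> k.
have oT : open (setT : set R) by exact: openT.
have s2 : Ck_on k setT (fun t => flat 0 (2 - t)).
  have := @Ck_on_affine _ _ _ k setT setT (flat 0) (-%R : {linear R -> R}) 2 _ (fun _ _ => I)
    (Ck_flat k 0).
  move=> H; apply: Ck_on_ext (H _) => //; last by move=> x; exact: opp_continuous.
  by move=> q _; rewrite addrC.
have s1 : Ck_on k setT (fun t => flat 0 (t - 1)).
  have := @Ck_on_affine _ _ _ k setT setT (flat 0) (idfun : {linear R -> R}) (-1) _ (fun _ _ =>
    I) (Ck_flat k 0).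
  by move=> H; apply: Ck_on_ext (H _) => // x.
apply: Ck_onM => //; apply: Ck_onV => //; last exact: Ck_onD.
by move=> q _; rewrite gt_eqF ?smooth_step_den.
Qed.

End SmoothStep.

(** * Symbol estimates *)

Lemma compact_bounded_fun {R : realType} {T : topologicalType} (f : T -> R) (A : set T) :
  compact A ->
  (forall p, A p -> {for p, continuous f}) ->
  exists2 C : R, 0 < C & forall p, A p -> `|f p| <= C.
Proof.
move=> cA cf.
have : compact (f @` A).
  apply: continuous_compact cA; apply: continuous_in_subspaceT => p.
  by rewrite inE; exact: cf.
move=> /compact_bounded[M [Mr HM]].
exists (`|M| + 1); first by rewrite ltr_wpDl.
move=> p Ap; apply: HM; last by exists p.
by rewrite (le_lt_trans (ler_norm _)) // ltrDl.
Qed.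

Section StandardWords.
Context {R : realType} {n e : nat}.
Local Notation V := ('rV[R]_n * 'rV[R]_e)%type.
Local Notation I := ('I_n + 'I_e)%type.
Implicit Types (f g : V -> R) (p q v h : V) (U : set V) (ws : seq I).

Definition is_fiber (i : I) := if i is inr _ then true else false.

Definition fiber_order ws := count is_fiber ws.

Definition std_word (alpha : multi_index n) (beta : multi_index e) : seq I :=
  flatten [seq nseq (alpha k) (inl k) | k <- enum 'I_n] ++
  flatten [seq nseq (beta j) (inr j) | j <- enum 'I_e].

Lemma mpartialRE alpha beta f : mpartialR alpha beta f = dw f (std_word alpha beta).
Proof.
rewrite /mpartialR /std_word dw_cat.
have H (T : Type) (a : T -> nat) (b : T -> I) g (s : seq T) :
    dw g (flatten [seq nseq (a i) (b i) | i <- s]) =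
    foldr (fun i g => iter (a i) (fun g => 'D_(bvec (b i)) g) g) g s.
  elim: s => //= i s IH; rewrite dw_cat IH.
  by elim: (a i) => //= k ->.
by rewrite !H.
Qed.

Lemma fiber_order_std alpha beta : fiber_order (std_word alpha beta) = mi_size beta.
Proof.
rewrite /fiber_order /std_word count_cat !count_flatten !sumnE 4!big_map.
rewrite big1 => [|i _]; last by rewrite /= count_nseq.
rewrite add0n big_enum; apply: eq_bigr => j _.
by rewrite /= count_nseq mul1n.
Qed.

(** The multi-indices count the letters of the word. Together with [dw_perm] this makes estimates
    over words equivalent to estimates over multi-indices. *)
Lemma word_perm_std ws : exists alpha beta, perm_eq ws (std_word alpha beta).
Proof.
exists (fun i => count_mem (inl i : I) ws), (fun j => count_mem (inr j : I) ws).
have H (T : finType) (b : T -> I) (bI : injective b) (i : T) :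
   count_mem (b i) (flatten [seq nseq (count_mem (b k) ws) (b k) | k <- enum T]) =
   count_mem (b i) ws.
  rewrite count_flatten -map_comp sumnE big_map big_enum /= (bigD1 i) //= big1.
    by rewrite addn0 count_nseq /= eqxx mul1n.
  by move=> k ki; rewrite count_nseq /= (inj_eq bI) (negPf ki).
have H0 (T : finType) (b : T -> I) (c : T -> nat) i : (forall k, b k != i) ->
   count_mem i (flatten [seq nseq (c k) (b k) | k <- enum T]) = 0%N.
  move=> bi; rewrite count_flatten -map_comp sumnE big_map big1 // => k _ /=.
  by rewrite count_nseq /= (negPf (bi k)).
apply/allP => -[i|j] _; apply/eqP; rewrite /std_word count_cat.
  by rewrite [X in (_ + X)%N]H0 // addn0 (H _ inl) // => k l [].
by rewrite [X in (X + _)%N]H0 // add0n (H _ inr) // => k l [].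
Qed.

Lemma fiber_order_perm ws ws' : perm_eq ws ws' -> fiber_order ws = fiber_order ws'.
Proof. by move=> /permP; exact. Qed.

(* s k = m - k gives symbols of order m; constant s gives decay without gain. *)
Definition dbound (s : nat -> R) f := forall (K : set 'rV[R]_n) ws, compact K ->
  exists2 C : R, 0 < C & forall (x : 'rV[R]_n) (w : 'rV[R]_e), K x ->
    `|dw f ws (x, w)| <= C * (1 + `|w|) `^ s (fiber_order ws).

Lemma modulus_le (z : R[i]) : modulus z <= `|complex.Re z| + `|complex.Im z|.
Proof.
case: z => a b; rewrite /modulus /=.
rewrite -[leRHS]ger0_norm ?addr_ge0 // -sqrtr_sqr ler_wsqrtr //.
by rewrite sqrrD !real_normK ?num_real // lerD2r lerDl mulrn_wge0 // mulr_ge0.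
Qed.

Lemma Re_le_modulus (z : R[i]) : `|complex.Re z| <= modulus z.
Proof.
case: z => a b; rewrite /modulus /= -sqrtr_sqr ler_wsqrtr //.
by rewrite lerDl sqr_ge0.
Qed.

Lemma Im_le_modulus (z : R[i]) : `|complex.Im z| <= modulus z.
Proof.
case: z => a b; rewrite /modulus /= -sqrtr_sqr ler_wsqrtr //.
by rewrite lerDr sqr_ge0.
Qed.

Lemma wt_le (w : 'rV[R]_e) (s s' : R) : s <= s' -> (1 + `|w|) `^ s <= (1 + `|w|) `^ s'.
Proof. by move=> ss; rewrite ler_powR // lerDl. Qed.

Lemma dbound_complex (s : nat -> R) (a : V -> R[i]) : smooth_on setT a ->
  (forall (K : set 'rV[R]_n) alpha beta, compact K ->
    exists2 C : R, 0 < C & forall (x : 'rV[R]_n) (w : 'rV[R]_e), K x ->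
      modulus (mpartial alpha beta a (x, w)) <= C * (1 + `|w|) `^ s (mi_size beta))
  <-> dbound s (re_part a) /\ dbound s (im_part a).
Proof.
move=> /smooth_onE[s1 s2]; split=> [H|[H1 H2] K alpha beta cK].
  split=> K ws cK; have [alpha [beta wsP]] := word_perm_std ws;
    have [C C0 HC] := H K alpha beta cK; exists C => // x w Kx.
    rewrite (dw_perm openT s1 wsP) // (fiber_order_perm wsP) fiber_order_std.
    by rewrite -mpartialRE (le_trans _ (HC x w Kx)) // (le_trans _ (Re_le_modulus _)).
  rewrite (dw_perm openT s2 wsP) // (fiber_order_perm wsP) fiber_order_std.
  by rewrite -mpartialRE (le_trans _ (HC x w Kx)) // (le_trans _ (Im_le_modulus _)).
have [C1 C10 HC1] := H1 K (std_word alpha beta) cK.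
have [C2 C20 HC2] := H2 K (std_word alpha beta) cK.
exists (C1 + C2); first exact: addr_gt0.
move=> x w Kx; rewrite (le_trans (modulus_le _)) //= !mpartialRE mulrDl.
by rewrite -(fiber_order_std alpha) lerD ?HC1 ?HC2.
Qed.

Lemma symbolE (m : R) (a : V -> R[i]) : symbol m a <->
  [/\ smooth_on setT a, dbound (fun k => m - k%:R) (re_part a) &
      dbound (fun k => m - k%:R) (im_part a)].
Proof.
split=> [[sa H]|[sa H1 H2]].
  by have [H1 H2] := (dbound_complex (fun k => m - k%:R) sa).1 H; split.
by split=> //; apply: (dbound_complex (fun k => m - k%:R) sa).2.
Qed.

Definition rapid f := forall N : nat, dbound (fun=> - N%:R) f.

Lemma schwartzE (a : V -> R[i]) : schwartz a <->
  [/\ smooth_on setT a, rapid (re_part a) & rapid (im_part a)].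
Proof.
have E N (w : 'rV[R]_e) : (1 + `|w|) ^- N = (1 + `|w|) `^ (- N%:R).
  by rewrite powRN powR_mulrn // addr_ge0.
split=> [[sa H]|[sa H1 H2]].
  have HN N := (dbound_complex (fun=> - N%:R) sa).1.
  split=> // N; have [] // := HN N => K alpha beta cK;
    have [C C0 HC] := H K N alpha beta cK; exists C => // x w Kx; rewrite -E; exact: HC.
split=> // K N alpha beta cK.
have [C C0 HC] := (dbound_complex (fun=> - N%:R) sa).2 (conj (H1 N) (H2 N)) K alpha beta cK.
by exists C => // x w Kx; rewrite E; exact: HC.
Qed.

Lemma dbound_le (s s' : nat -> R) f : (forall k, s k <= s' k) -> dbound s f -> dbound s' f.
Proof.
move=> ss H K ws cK; have [C C0 HC] := H K ws cK; exists C => // x w Kx.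
by rewrite (le_trans (HC x w Kx)) // ler_wpM2l ?(ltW C0) // wt_le.
Qed.

Lemma dboundD (s : nat -> R) f g : smooth setT f -> smooth setT g ->
  dbound s f -> dbound s g -> dbound s (fun q => f q + g q).
Proof.
move=> sf sg Hf Hg K ws cK; have [C C0 HC] := Hf K ws cK.
have [C' C'0 HC'] := Hg K ws cK; exists (C + C'); first exact: addr_gt0.
move=> x w Kx; rewrite (dwD _ openT) // (le_trans (ler_normD _ _)) // mulrDl.
by rewrite lerD ?HC ?HC'.
Qed.

Lemma dboundB (s : nat -> R) f g : smooth setT f -> smooth setT g ->
  dbound s f -> dbound s g -> dbound s (fun q => f q - g q).
Proof.
move=> sf sg Hf Hg K ws cK; have [C C0 HC] := Hf K ws cK.
have [C' C'0 HC'] := Hg K ws cK; exists (C + C'); first exact: addr_gt0.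
move=> x w Kx; rewrite (dwB _ openT) // (le_trans (ler_normB _ _)) // mulrDl.
by rewrite lerD ?HC ?HC'.
Qed.

Lemma compact_row_ball k (r : R) (A : set 'rV[R]_k) : closed A ->
  (forall w, A w -> `|w| <= r) -> compact A.
Proof.
move=> cA Ar; apply: bounded_closed_compact => //.
by exists r; split; [exact: num_real|move=> M rM w Aw; exact: le_trans (Ar w Aw) (ltW rM)].
Qed.

Lemma closed_norm_le k (r : R) : closed [set w : 'rV[R]_k | `|w| <= r].
Proof.
apply: (@preimage_closed _ _ (fun w : 'rV[R]_k => `|w|) [set y : R | y <= r]); last exact:
  closed_le.
by move=> w _; exact: norm_continuous.
Qed.

(** For x in K and |w| <= r the derivative is bounded by compactness, while the weight (1 + |w|)^t
    is at least (1 + |r|)^(-|t|). Only large w matter. *)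
Lemma dbound_outside (s : nat -> R) f (r : R) : smooth setT f ->
  (forall (K : set 'rV[R]_n) ws, compact K ->
    exists2 C : R, 0 < C & forall (x : 'rV[R]_n) (w : 'rV[R]_e), K x -> r < `|w| ->
      `|dw f ws (x, w)| <= C * (1 + `|w|) `^ s (fiber_order ws)) ->
  dbound s f.
Proof.
move=> sf H K ws cK; have [C C0 HC] := H K ws cK.
have cB : compact [set w : 'rV[R]_e | `|w| <= r].
  by apply: (@compact_row_ball e r) => //; exact: closed_norm_le.
have [C' C'0 HC'] := compact_bounded_fun (compact_setX cK cB)
  (fun p _ => smooth_continuous (smooth_dw ws sf) (Logic.I : setT p)).
set t := s _.
exists (C + C' * (1 + `|r|) `^ `|t|).
  by rewrite addr_gt0 // mulr_gt0 // powR_gt0 // ltr_wpDr.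
move=> x w Kx; rewrite mulrDl; have [wr|rw] := leP `|w| r; last first.
  by rewrite (le_trans (HC x w Kx rw)) // lerDl !mulr_ge0 ?powR_ge0 // ltW.
rewrite (le_trans (HC' (x, w) _)) // ler_wpDl ?mulr_ge0 ?powR_ge0 ?(ltW C0) //.
rewrite -mulrA ler_peMr ?(ltW C'0) //.
have w1 : 1 <= 1 + `|w| by rewrite lerDl.
have r1 : 1 <= 1 + `|r| by rewrite lerDl.
have wr1 : 1 + `|w| <= 1 + `|r| by rewrite lerD2l (le_trans wr) // ler_norm.
apply: (@le_trans _ _ ((1 + `|w|) `^ `|t| * (1 + `|w|) `^ t)).
  rewrite -powRD; last by apply/implyP => _; rewrite gt_eqF // ltr_wpDr.
  rewrite -[leLHS](@powRr0 _ (1 + `|w|)) ler_powR //.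
  by rewrite -lerBlDr sub0r -normrN ler_norm.
rewrite ler_wpM2r ?powR_ge0 // ge0_ler_powR // nnegrE ?addr_ge0 //.
Qed.

End StandardWords.

(** * Derivatives under linear maps, dilations and slices *)

Section LinearMaps.
Context {R : realType} {n e : nat}.
Local Notation V := ('rV[R]_n * 'rV[R]_e)%type.
Local Notation I := ('I_n + 'I_e)%type.

Lemma continuous_linear (W : normedModType R) (L : {linear V -> W}) : continuous L.
Proof.
have -> : (L : V -> W) = fun v => \sum_i coord i v *: L (bvec i).
  by apply/funext => v; rewrite [in LHS](vec_basis v) linear_sum; apply: eq_bigr => i _; rewrite
    linearZ.
move=> q; rewrite /continuous_at.
elim: (index_enum _) => [|i s IH].
  by rewrite big_nil; under eq_fun do rewrite big_nil; exact: cvg_cst.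
rewrite big_cons; under eq_fun do rewrite big_cons.
by apply: cvgD => //; apply: cvgZr_tmp; exact: continuous_coord.
Qed.

Lemma open_preimage_linear (W : normedModType R) (L : {linear V -> W}) (U : set W) :
  open U -> open (L @^-1` U).
Proof. by move=> oU; apply: open_comp => // p _; exact: continuous_linear. Qed.

Lemma derive_scale (f : V -> R) p (c : R) v : differentiable f p ->
  'D_(c *: v) f p = c * 'D_v f p.
Proof. by move=> df; rewrite !deriveE // linearZ. Qed.

(** Each letter brings out the factor by which L scales its direction. It is applied to the
    dilations of the fiber and to the rescaling of t alone. *)
Lemma dw_diag (L : {linear V -> V}) (c : I -> R) (U : set V) (f : V -> R) ws :
  (forall i, L (bvec i) = c i *: bvec i) -> open U -> smooth U f ->
  forall p, U (L p) -> dw (f \o L) ws p = (\prod_(i <- ws) c i) * dw f ws (L p).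
Proof.
move=> Lc oU sf; have oO := open_preimage_linear (L := L) oU.
elim: ws => [|i ws IH] p Up; first by rewrite big_nil mul1r.
rewrite big_cons /= (@derive_open_ext _ _ (L @^-1` U) _ (fun q => (\prod_(i <- ws) c i) * dw f
  ws (L q))) //.
have dfL : differentiable (dw f ws) (L p).
  exact: smooth_differentiable (smooth_dw ws sf) Up.
rewrite deriveMl; last first.
  apply/diff_derivable/(differentiable_comp (f := L)) => //.
  exact/linear_differentiable/continuous_linear.
rewrite -[X in _ * X]/('D_(bvec i) (dw f ws \o L) p).
rewrite (@derive_affine _ _ _ _ _ _ (c i *: bvec i)); last first.
  by move=> h; rewrite linearP Lc.
by rewrite derive_scale // mulrA (mulrC (c i)).
Qed.

End LinearMaps.

(** Each letter is an instance of [derive_affine], so this is an identity between functions. It is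
    applied to the slices at constant t, where sigma is the inclusion of directions. *)
Lemma dw_embed {R : realType} {n e n' e' : nat}
    (A : 'rV[R]_n * 'rV[R]_e -> 'rV[R]_n' * 'rV[R]_e')
    (sigma : 'I_n + 'I_e -> 'I_n' + 'I_e') (f : 'rV[R]_n' * 'rV[R]_e' -> R) ws :
  (forall i h p, A (h *: bvec i + p) = h *: bvec (sigma i) + A p) ->
  dw (f \o A) ws = dw f (map sigma ws) \o A.
Proof.
move=> HA; elim: ws => //= i ws ->; apply/funext => p.
by apply: derive_affine => h.
Qed.

Section FiberMaps.
Context {R : realType} {n d : nat}.
Local Notation V := ('rV[R]_n * 'rV[R]_d)%type.
Local Notation W := ('rV[R]_n * 'rV[R]_(d + 1))%type.
Local Notation I := ('I_n + 'I_d)%type.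
Local Notation J := ('I_n + 'I_(d + 1))%type.

Definition fiber_scale k (s : R) (p : 'rV[R]_n * 'rV[R]_k) : 'rV[R]_n * 'rV[R]_k :=
  (p.1, s *: p.2).

Definition fproj (p : W) : V := (p.1, lsubmx p.2).

Definition tcoord (p : W) : R := p.2 0 (rshift d 0).

Definition slice (t : R) (p : V) : W := (p.1, fiber_pt p.2 t).

Definition tscale (c : R) (p : W) : W := (p.1, row_mx (lsubmx p.2) (c *: rsubmx p.2)).

Definition tindex : J := inr (rshift d 0).

Definition slice_index (i : I) : J :=
  match i with inl k => inl k | inr k => inr (lshift 1 k) end.

(** Partial inverse of [slice_index]; [None] marks the direction of t. *)
Definition base_index (i : J) : option I :=
  match i with
  | inl k => Some (inl k)
  | inr k => match fintype.split k with inl l => Some (inr l) | inr _ => None end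
  end.

Lemma fiber_scale_is_linear k s : linear (@fiber_scale k s).
Proof.
move=> a p q; rewrite /fiber_scale /=; congr (_, _).
by rewrite scalerDr /= !scalerA (mulrC s).
Qed.
HB.instance Definition _ k s :=
  GRing.isLinear.Build R _ _ _ (@fiber_scale k s) (@fiber_scale_is_linear k s).

Lemma fproj_is_linear : linear fproj.
Proof. by move=> a p q; rewrite /fproj /=; congr (_, _); rewrite linearP. Qed.
HB.instance Definition _ := GRing.isLinear.Build R _ _ _ fproj fproj_is_linear.

Lemma tcoord_is_linear : linear tcoord.
Proof. by move=> a p q; rewrite /tcoord /= !mxE. Qed.
HB.instance Definition _ := GRing.isLinear.Build R W R _ tcoord tcoord_is_linear.

Lemma tscale_is_linear c : linear (tscale c).
Proof.
move=> a p q; rewrite /tscale /=; congr (_, _).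
by rewrite !linearP /= scale_row_mx add_row_mx !scalerA (mulrC a).
Qed.
HB.instance Definition _ c := GRing.isLinear.Build R _ _ _ (tscale c) (tscale_is_linear c).

Lemma slice0_is_linear : linear (slice 0).
Proof.
move=> a p q; rewrite /slice /fiber_pt /=; congr (_, _).
by rewrite /= scale_row_mx add_row_mx !raddf0 addr0.
Qed.
HB.instance Definition _ := GRing.isLinear.Build R _ _ _ (slice 0) slice0_is_linear.

(** Each slice is affine with linear part [slice 0]; affine composition rules are applied through
    this decomposition. *)
Lemma sliceE t p : slice t p = slice 0 p + slice t 0.
Proof.
rewrite /slice /fiber_pt; congr (_, _); rewrite /= ?addr0 //.
by rewrite add_row_mx addr0 !raddf0 add0r.
Qed.

Lemma fproj_slice t p : fproj (slice t p) = p.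
Proof. by case: p => x xi; rewrite /fproj /slice /fiber_pt /= row_mxKl. Qed.

Lemma tcoord_slice t p : tcoord (slice t p) = t.
Proof. by rewrite /tcoord /slice /fiber_pt /= row_mxEr mxE. Qed.

Lemma slice_surj p : p = slice (tcoord p) (fproj p).
Proof.
case: p => x w; rewrite /slice /fiber_pt /tcoord /fproj /=; congr (_, _).
rewrite -[LHS]hsubmxK; congr (row_mx _ _).
by apply/matrixP => i j; rewrite !ord1 !mxE.
Qed.

Lemma fiber_scale_slice s t p : fiber_scale s (slice t p) = slice (s * t) (fiber_scale s p).
Proof.
rewrite /fiber_scale /slice /fiber_pt /=; congr (_, _).
by rewrite scale_row_mx scale_scalar_mx.
Qed.

Lemma tscale_slice c t p : tscale c (slice t p) = slice (c * t) p.
Proof.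
rewrite /tscale /slice /fiber_pt /=; congr (_, _).
by rewrite row_mxKl row_mxKr scale_scalar_mx.
Qed.

Lemma slice_affine t i h p : slice t (h *: bvec i + p) = h *: bvec (slice_index i) + slice t p.
Proof.
rewrite sliceE linearP -addrA -sliceE; congr (_ *: _ + _).
case: i => k; rewrite /slice /fiber_pt /=; congr (_, _).
  by rewrite /fiber_pt raddf0 row_mx0.
by rewrite /fiber_pt delta_mx_lshift raddf0.
Qed.

Lemma fiber_scale_bvec k s (i : 'I_n + 'I_k) :
  fiber_scale s (bvec i) = (if is_fiber i then s else 1) *: bvec i :> 'rV[R]_n * 'rV[R]_k.
Proof.
case: i => j; rewrite /fiber_scale /=; first by rewrite scale1r scaler0.
by rewrite -[RHS]/(_ *: _, _ *: _) scaler0.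
Qed.

Lemma tscale_bvec c i : tscale c (bvec i) = (if i == tindex then c else 1) *: bvec i.
Proof.
case: i => j; rewrite /tscale /=.
  by rewrite scale1r !raddf0 row_mx0.
rewrite /tindex; case: (split_ordP j) => k ->.
  rewrite delta_mx_lshift row_mxKl row_mxKr scaler0 ifN ?scale1r //.
  by apply/eqP => -[E]; have := ltn_ord k; rewrite E addn0 ltnn.
rewrite delta_mx_rshift row_mxKl row_mxKr ord1 eqxx.
by rewrite -[RHS]/(_ *: _, _ *: _) scaler0 scale_row_mx scaler0.
Qed.

Lemma bvec_split i : (fproj (bvec i) = if base_index i is Some j then bvec j else 0) *
  (tcoord (bvec i) = if base_index i is Some j then 0 else 1).
Proof.
case: i => j; rewrite /fproj /tcoord /=; first by rewrite raddf0 mxE.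
case: split_ordP => k ->; rewrite ?delta_mx_lshift ?delta_mx_rshift row_mxKl row_mxEr.
  by rewrite mxE.
by rewrite ord1 mxE !eqxx.
Qed.

End FiberMaps.

Lemma smooth_comp_linear {R : realType} {n e : nat} {W : normedModType R}
    (L : {linear ('rV[R]_n * 'rV[R]_e)%type -> W}) (U : set ('rV[R]_n * 'rV[R]_e))
    (U' : set W) (f : W -> R) :
  open U -> (forall p, U p -> U' (L p)) -> smooth U' f -> smooth U (f \o L).
Proof.
move=> oU UU' sf k.
have := @Ck_on_affine R _ _ k U U' f L 0 (@continuous_linear R n e W L).
move=> H; apply: Ck_on_ext (H _ (sf k)) => //.
  by move=> q _ /=; rewrite addr0.
by move=> p /UU'; rewrite addr0.
Qed.

Lemma smooth_comp1 {R : realType} {V : normedModType R} (U : set V) (h : R -> R)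
    (f : V -> R) : open U -> smooth setT h -> smooth U f -> smooth U (h \o f).
Proof. by move=> oU sh sf k; apply: (@Ck_on_comp1 _ _ k U setT). Qed.

Lemma smooth_linear {R : realType} {n e : nat}
    (L : {linear ('rV[R]_n * 'rV[R]_e)%type -> R}) (U : set ('rV[R]_n * 'rV[R]_e)) :
  smooth U L.
Proof. by move=> k; apply: Ck_on_linear; exact: continuous_linear. Qed.

(** * Taylor's formula and products with a function of t *)

Section Taylor.
Context {R : realType}.

Lemma is_derive_bigsum (J : Type) (r : seq J) (f : J -> R -> R) (df : J -> R) (t : R) :
  (forall j, is_derive t 1 (f j) (df j)) ->
  is_derive t 1 (fun t => \sum_(j <- r) f j t) (\sum_(j <- r) df j).
Proof.
move=> H; elim: r => [|j r IH].
  by rewrite big_nil; under eq_fun do rewrite big_nil; exact: is_derive_cst.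
by rewrite big_cons; under eq_fun do rewrite big_cons; exact: is_deriveD.
Qed.

(** F lists the successive derivatives. The error vanishes at 0 and its derivative is the error for
    the shifted list, bounded by M by induction; the mean value theorem on [0, t] with t <= 1
    preserves the bound M. *)
Lemma taylor_bound (F : nat -> R -> R) N (M : R) : 0 <= M ->
  (forall j (t : R), (j < N)%N -> 0 <= t <= 1 -> is_derive t 1 (F j) (F j.+1 t)) ->
  (forall t : R, 0 <= t <= 1 -> `|F N t| <= M) ->
  forall t : R, 0 <= t <= 1 -> `|F 0%N t - \sum_(j < N) (j`!%:R)^-1 * F j 0 * t ^+ j| <= M.
Proof.
move=> M0; elim: N F => [|N IH] F dF FM t t01.
  by rewrite big_ord0 subr0; exact: FM.
pose E t := F 0%N t - \sum_(j < N.+1) (j`!%:R)^-1 * F j 0 * t ^+ j.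
pose dE t := F 1%N t - \sum_(j < N) (j`!%:R)^-1 * F j.+1 0 * t ^+ j.
have HE (x : R) : 0 <= x <= 1 -> is_derive x 1 E (dE x).
  move=> x01; apply: is_deriveB; first exact: dF.
  have -> : (fun t => \sum_(j < N.+1) (j`!%:R)^-1 * F j 0 * t ^+ j) =
     (fun t => F 0%N 0 + \sum_(j < N) (j.+1`!%:R)^-1 * F j.+1 0 * t ^+ j.+1).
    apply/funext => y; rewrite big_ord_recl /= fact0 invr1 mul1r expr0 mulr1.
    by congr (_ + _); apply: eq_bigr => j _; rewrite /bump /= add1n.
  rewrite -[X in is_derive _ _ _ X]add0r; apply: is_deriveD.
  apply: is_derive_bigsum => j; set c := _^-1 * _.
  have dX : is_derive x 1 (fun y : R => y ^+ j.+1) (j.+1%:R * x ^+ j).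
    apply: DeriveDef; first exact: exprn_derivable.
    by rewrite exp_derive scaler1.
  apply: is_derive_eq (is_deriveZ c dX) _.
  rewrite /GRing.scale /= /c factS natrM invfM; field.
  by rewrite !pnatr_eq0 -lt0n fact_gt0 /=.
have E0 : E 0 = 0.
  rewrite /E big_ord_recl /= fact0 invr1 mul1r expr0 mulr1 big1 ?addr0 ?subrr //.
  by move=> j _; rewrite /bump /= add1n expr0n mulr0.
have dEM (x : R) : 0 <= x <= 1 -> `|dE x| <= M.
  move=> x01; apply: (IH (fun j => F j.+1)) => // j y jN; exact: dF.
have t0 : 0 <= t by case/andP: t01.
have sub (x : R) : 0 <= x <= t -> 0 <= x <= 1.
  by move: t01 => /andP[_ t1] /andP[-> /le_trans] ->.
have [x||c] := @MVT_segment R E dE 0 t t0.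
- by rewrite in_itv /= => /andP[x0 xt]; apply: HE; apply: sub; rewrite !ltW.
- apply: continuous_in_subspaceT => x; rewrite inE /= in_itv /= => /sub/HE[dx _].
  by apply: differentiable_continuous; apply/derivable1_diffP.
rewrite in_itv /= E0 !subr0 => /sub c01 Et.
rewrite -/(E t) Et normrM (le_trans (ler_pM _ _ (dEM c c01) (lexx _))) //.
by rewrite ger0_norm // ler_piMr //; case/andP: t01.
Qed.

End Taylor.

Section Tensor.
Context {R : realType} {n d : nat}.
Local Notation V := ('rV[R]_n * 'rV[R]_d)%type.
Local Notation W := ('rV[R]_n * 'rV[R]_(d + 1))%type.

Lemma derive1_linear_comp k (g : R -> R) (L : {linear ('rV[R]_n * 'rV[R]_k)%type -> R}) p v :
  differentiable g (L p) -> 'D_v (g \o L) p = L v * 'D_1 g (L p).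
Proof.
move=> dg; rewrite (@derive_affine _ _ _ _ _ _ (L v)); last by move=> h; rewrite linearP.
by rewrite -[in LHS](mulr1 (L v)) -[_ * _]/(_ *: _) !deriveE // linearZ.
Qed.

Lemma open_fproj (U : set V) : open U -> open (@fproj R n d @^-1` U).
Proof.
by move=> oU; exact: (@open_preimage_linear R n (d + 1)%N _ (fproj : {linear W -> V})).
Qed.

Definition D1 (g : R -> R) : R -> R := 'D_1 g.

Lemma smooth_iter_derive (h : R -> R) k : smooth setT h ->
  smooth setT (iter k D1 h).
Proof. by move=> sh; elim: k => // k IH j; have [_ H] := IH j.+1; exact: H. Qed.

Definition base_word (ws : seq ('I_n + 'I_(d + 1))) : seq ('I_n + 'I_d) :=
  pmap base_index ws.

Definition torder (ws : seq ('I_n + 'I_(d + 1))) : nat :=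
  count (fun i => ~~ isSome (base_index i)) ws.

(** Every letter acts on one factor only, the direction of t on h and the others on f, so Leibniz's
    rule leaves a single term. *)
Lemma dw_tensor (U : set V) (f : V -> R) (h : R -> R) ws : open U -> smooth U f ->
  smooth setT h -> forall p : W, U (fproj p) ->
  dw (fun p => f (fproj p) * h (tcoord p)) ws p =
  dw f (base_word ws) (fproj p) * iter (torder ws) D1 h (tcoord p).
Proof.
move=> oU sf sh; have oO := open_fproj oU.
elim: ws => //= i ws IH p Up.
set g := dw f (base_word ws); pose k := iter (torder ws) D1 h.
have dg : differentiable g (fproj p) by exact: smooth_differentiable (smooth_dw _ sf) Up.
have dk t : differentiable k t by exact: smooth_differentiable (smooth_iter_derive _ sh) _.
rewrite (derive_open_ext (bvec i) oO IH) // -/g -/k.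
have dgp : differentiable (g \o fproj) p.
  by apply: (differentiable_comp (f := fproj)) => //;
    exact/linear_differentiable/continuous_linear.
have dkp : differentiable (k \o tcoord) p.
  by apply: (differentiable_comp (f := tcoord)) => //;
    exact/linear_differentiable/continuous_linear.
have := deriveM (@diff_derivable _ _ _ _ _ (bvec i) dgp) (@diff_derivable _ _ _ _ _ (bvec i) dkp).
rewrite -[X in 'D_(bvec i) X p]/(fun p => g (fproj p) * k (tcoord p)) => ->.
rewrite derive1_linear_comp // (@derive_affine _ _ _ g fproj _ (fproj (bvec i))); last first.
  by move=> h'; rewrite linearP.
rewrite /= !bvec_split /torder /base_word /=; case: (base_index i) => [j|] /=.
  by rewrite mul0r scaler0 add0r mulrC.
by rewrite derive0 scaler0 addr0 mul1r.
Qed.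

End Tensor.

(** * Homogeneous functions *)

Lemma derivable_affine {R : realType} {V W : normedModType R} (f : W -> R)
    (A : V -> W) (v : V) (w : W) (p : V) :
  (forall h : R, A (h *: v + p) = h *: w + A p) ->
  derivable f (A p) w -> derivable (f \o A) p v.
Proof.
move=> HA; rewrite /derivable; set F := (X in cvg (X @ _)); set G := (X in _ -> cvg (X @ _)).
by suff -> : G = F by []; apply/funext => h; rewrite /F /G /= HA.
Qed.

(** From y <= 1 + y <= 2 y, the second inequality being the one for s < 0. It turns homogeneous
    bounds in |xi| into bounds by the weight 1 + |xi|. *)
Lemma powR_le_shift {R : realType} (y s : R) : 1 <= y ->
  y `^ s <= 2 `^ `|s| * (1 + y) `^ s.
Proof.
move=> y1; have y0 : 0 < y by exact: lt_le_trans y1.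
have y10 : 0 < 1 + y by rewrite addr_gt0.
have two1 : (1 : R) <= 2 `^ `|s|.
  by rewrite -[leLHS](powRr0 2) ler_powR // ler1n.
have [s0|s0] := leP 0 s.
  apply: (@le_trans _ _ ((1 + y) `^ s)).
    by rewrite ge0_ler_powR // ?nnegrE ?ltW // ltrDr.
  by rewrite ler_peMl // powR_ge0.
rewrite ltr0_norm // -[s in leLHS]opprK -[X in _ * _ `^ X]opprK (powRN y) (powRN (1 + y)).
rewrite ler_pdivlMr ?powR_gt0 // mulrC ler_pdivrMr ?powR_gt0 //.
have y2 : 0 <= 2 * y by rewrite mulr_ge0 // ltW.
rewrite -powRM ?(ltW y0) ?ler0n //; apply: ge0_ler_powR; rewrite ?nnegrE ?oppr_ge0 ?(ltW s0)
  ?(ltW y10) //.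
by rewrite mulr_natl mulr2n lerD2r.
Qed.

Section RowMxNorm.
Context {R : realType} {d : nat}.

Lemma norm_lsubmx (w : 'rV[R]_(d + 1)) : `|lsubmx w| <= `|w|.
Proof. by apply: norm_row_le => // j; rewrite mxE norm_entry. Qed.

Lemma norm_fiber_pt_le (xi : 'rV[R]_d) (t r : R) :
  `|xi| <= r -> `|t| <= r -> `|fiber_pt xi t| <= r.
Proof.
move=> xir tr; apply: norm_row_le; first exact: le_trans tr.
move=> j; rewrite /fiber_pt; case: (split_ordP j) => k ->.
  by rewrite row_mxEl (le_trans (norm_entry _ _)).
by rewrite row_mxEr ord1 mxE.
Qed.

Lemma norm_le_fiber_pt (xi : 'rV[R]_d) (t : R) : `|xi| <= `|fiber_pt xi t|.
Proof. by have := norm_lsubmx (fiber_pt xi t); rewrite row_mxKl. Qed.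

End RowMxNorm.

Section Homogeneous.
Context {R : realType} {n d : nat}.
Local Notation V := ('rV[R]_n * 'rV[R]_d)%type.
Local Notation W := ('rV[R]_n * 'rV[R]_(d + 1))%type.
Local Notation I := ('I_n + 'I_d)%type.
Local Notation J := ('I_n + 'I_(d + 1))%type.
Implicit Types (v : W -> R) (a : V -> R).

Lemma norm_fiber_le (p : W) (r : R) :
  `|(fproj p).2| <= r -> `|tcoord p| <= r -> `|p.2| <= r.
Proof. by move=> p1 p2; rewrite [p in `|p.2|]slice_surj; exact: norm_fiber_pt_le. Qed.

(* Homogeneous functions are only used off xi = 0, although (xi, t) may be
   nonzero there: the expansion takes place at t = 0. *)
Definition punctured : set V := [set p | p.2 != 0].

Definition punctured1 : set W := fproj @^-1` punctured.

Lemma open_norm_snd_gt k (r : R) : open [set p : 'rV[R]_n * 'rV[R]_k | r < `|p.2|].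
Proof.
apply: (@open_comp _ _ (fun p : 'rV[R]_n * 'rV[R]_k => `|p.2|) [set y : R | r < y]).
  move=> p _; apply: (continuous_comp (f := snd) (g := fun w : 'rV[R]_k => `|w|)).
    exact: cvg_snd.
  exact: norm_continuous.
exact: open_gt.
Qed.

Lemma open_norm_snd_lt k (r : R) : open [set p : 'rV[R]_n * 'rV[R]_k | `|p.2| < r].
Proof.
apply: (@open_comp _ _ (fun p : 'rV[R]_n * 'rV[R]_k => `|p.2|) [set y : R | y < r]).
  move=> p _; apply: (continuous_comp (f := snd) (g := fun w : 'rV[R]_k => `|w|)).
    exact: cvg_snd.
  exact: norm_continuous.
exact: open_lt.
Qed.

Lemma open_punctured : open punctured.
Proof.
have -> : punctured = [set p : V | 0 < `|p.2|] by apply/funext => p; rewrite /punctured /=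
  normr_gt0.
exact: open_norm_snd_gt.
Qed.

Lemma open_punctured1 : open punctured1.
Proof. exact/open_fproj/open_punctured. Qed.

Lemma fproj_fiber_scale s (p : W) : fproj (fiber_scale s p) = fiber_scale s (fproj p).
Proof. by rewrite /fproj /fiber_scale /= linearZ. Qed.

Lemma punctured1_scale s p : 0 < s -> punctured1 p -> punctured1 (fiber_scale s p).
Proof.
move=> s0; rewrite /punctured1 /preimage /= fproj_fiber_scale /punctured /=.
by rewrite scaler_eq0 gt_eqF.
Qed.

Definition homogeneous (m : R) v := forall p (s : R), 0 < s -> punctured1 p ->
  v (fiber_scale s p) = s `^ m * v p.

Lemma dw_fiber_scale k (U : set ('rV[R]_n * 'rV[R]_k)) f (s : R) ws : open U -> smooth U f ->
  forall p, U (fiber_scale s p) ->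
  dw (fun q => f (fiber_scale s q)) ws p = s ^+ fiber_order ws * dw f ws (fiber_scale s p).
Proof.
move=> oU sf p Up.
have H := @dw_diag R n k (@fiber_scale R n k s : {linear _ -> _}) _ U f ws (@fiber_scale_bvec R
  n k s) oU sf p Up.
rewrite -[X in dw X]/(f \o fiber_scale s) H; congr (_ * _).
elim: ws {H} => [|i ws IH]; first by rewrite big_nil.
by rewrite big_cons IH /=; case: is_fiber; rewrite ?mul1r // exprS.
Qed.

(** Differentiating v (s p) = s^m v p along ws brings out one factor s on the left for each fiber
    letter; division by it lowers the degree. *)
Lemma dw_homogeneous m v ws : smooth punctured1 v -> homogeneous m v ->
  homogeneous (m - (fiber_order ws)%:R) (dw v ws).
Proof.
move=> sv hv p s s0 Pp.
have Psp := punctured1_scale s0 Pp.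
have E : dw (fun q => v (fiber_scale s q)) ws p = s `^ m * dw v ws p.
  rewrite -(dwZ _ _ open_punctured1 sv) //; apply: (dw_ext _ open_punctured1) => // q Pq.
  exact: hv.
have := dw_fiber_scale ws open_punctured1 sv Psp; rewrite E => E2.
have sk : s ^+ fiber_order ws != 0 by rewrite expf_neq0 // gt_eqF.
apply: (mulfI sk); rewrite -E2 mulrA; congr (_ * _).
rewrite -powR_mulrn ?ltW // -powRD; last first.
  by apply/implyP => _; rewrite gt_eqF.
by congr (_ `^ _); rewrite addrC subrK.
Qed.

(** Dilation by 1/|xi| moves the cone |t| <= |xi| to the set B where |xi| = 1 and, in the sup norm,
    |(xi, t)| <= 1. This set is compact and avoids xi = 0. *)
Lemma homogeneous_bound mu (g : W -> R) (K : set 'rV[R]_n) : compact K ->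
  (forall p, punctured1 p -> {for p, continuous g}) -> homogeneous mu g ->
  exists2 C : R, 0 < C & forall (x : 'rV[R]_n) (xi : 'rV[R]_d) (t : R), K x -> xi != 0 -> `|t|
    <= `|xi| ->
    `|g (slice t (x, xi))| <= C * `|xi| `^ mu.
Proof.
move=> cK cg hg.
pose B := [set w : 'rV[R]_(d + 1) | `|lsubmx w| = 1] `&` [set w | `|w| <= 1].
have cB : compact B.
  apply: (@compact_row_ball _ _ 1); last by move=> w [].
  apply: closedI; last exact: closed_norm_le.
  apply: (@preimage_closed _ _ (fun w : 'rV[R]_(d + 1) => `|lsubmx w|) [set 1]); last exact:
    closed_eq.
  move=> w _; apply: (continuous_comp (f := lsubmx) (g := fun z : 'rV[R]_d => `|z|)).
    exact: continuous_lsubmx.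
  exact: norm_continuous.
have [|C C0 HC] := compact_bounded_fun (f := g) (compact_setX cK cB).
  move=> [x w] [_ [/= w1 _]]; apply: cg; rewrite /punctured1 /preimage /punctured /=.
  by rewrite -normr_eq0 w1 oner_eq0.
exists C => // x xi t Kx xi0 txi.
have s0 : 0 < `|xi| by rewrite normr_gt0.
have sN : `|xi| != 0 by rewrite gt_eqF.
have -> : slice t (x, xi) = fiber_scale `|xi| (slice (t / `|xi|) (x, `|xi|^-1 *: xi)).
  by rewrite fiber_scale_slice mulrC divfK // /fiber_scale /= scalerA divff // scale1r.
have n1 : `| `|xi|^-1 *: xi| = 1 by rewrite normrZ ger0_norm ?invr_ge0 // mulVf.
rewrite hg //; last first.
  by rewrite /punctured1 /preimage /= fproj_slice /punctured /= -normr_eq0 n1 oner_eq0.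
rewrite normrM ger0_norm ?powR_ge0 // mulrC ler_wpM2r ?powR_ge0 // HC //.
split; first exact: Kx.
split; rewrite /= ?row_mxKl //.
apply: norm_fiber_pt_le; rewrite ?n1 //.
by rewrite normrM normfV normr_id ler_pdivrMr // mul1r.
Qed.

(** Two regions cover the space: U, where both factors are smooth, and |p.2| < r, where the product
    is 0. *)
Lemma smooth_cutoff_mul k (chi : 'rV[R]_k -> R) (f : 'rV[R]_n * 'rV[R]_k -> R)
    (U : set ('rV[R]_n * 'rV[R]_k)) (r : R) :
  0 < r -> open U -> smooth setT chi -> (forall xi : 'rV[R]_k, `|xi| < r -> chi xi = 0) ->
  (forall p : 'rV[R]_n * 'rV[R]_k, p.2 != 0 -> U p) ->
  smooth U f -> smooth setT (fun p => chi p.2 * f p).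
Proof.
move=> r0 oU schi chi0 HU sf k'.
have -> : [set: 'rV[R]_n * 'rV[R]_k] = U `|` [set p | `|p.2| < r].
  apply/seteqP; split=> // p _; have [p0|p0] := eqVneq p.2 0; last by left; exact: HU.
  by right; rewrite /= p0 normr0.
apply: Ck_onU.
  apply: Ck_onM => //.
  exact: (@smooth_comp_linear R n k _ (snd : {linear ('rV[R]_n * 'rV[R]_k)%type -> _}) U setT).
apply: (Ck_on_ext (f := fun=> 0)); first exact: open_norm_snd_lt.
  by move=> q /chi0 ->; rewrite mul0r.
exact: Ck_on_cst.
Qed.

(* Taylor coefficients of v in t at t = 0; they are the terms of the expansion
   of the slice t = 1. *)
Definition tcoef v j : V -> R := fun p => (j`!%:R)^-1 * dw v (nseq j tindex) (slice 0 p).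

Lemma smooth_slice t v : smooth punctured1 v -> smooth punctured (v \o slice t).
Proof.
move=> sv k.
have := @Ck_on_affine R _ _ k punctured punctured1 v (slice 0 : {linear V -> W}) (slice t 0).
move=> H; apply: Ck_on_ext (H _ _ (sv k)).
- exact: open_punctured.
- by move=> q _ /=; rewrite -sliceE.
- exact: continuous_linear.
- by move=> p Pp; rewrite /= -sliceE /punctured1 /preimage /= fproj_slice.
Qed.

Lemma smooth_tcoef v j : smooth punctured1 v -> smooth punctured (tcoef v j).
Proof.
move=> sv; apply: smoothZ; first exact: open_punctured.
by apply: smooth_slice; exact: smooth_dw.
Qed.

Lemma slice_index_order ws : fiber_order (map (@slice_index n d) ws) = fiber_order ws.
Proof. by rewrite /fiber_order count_map; apply: eq_count => -[]. Qed.

Lemma tcoef_dw v j ws p : smooth punctured1 v -> punctured p ->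
  dw (tcoef v j) ws p = (j`!%:R)^-1 * dw v (nseq j tindex ++ map (@slice_index n d) ws) (slice 0
    p).
Proof.
move=> sv Pp; rewrite (dwZ _ _ open_punctured) //; last exact/smooth_slice/smooth_dw.
congr (_ * _).
rewrite -[X in dw X]/(dw v (nseq j tindex) \o slice 0) (dw_embed (sigma := @slice_index n d));
  last first.
  by move=> i h q; exact: slice_affine.
rewrite /= dw_cat; apply: (dw_comm _ _ open_punctured1 sv).
by rewrite /punctured1 /preimage /= fproj_slice.
Qed.

(** Taylor's formula in t, from 0 to 1, for the derivative of v along [ws']. For |xi| >= 1 this
    segment lies in the cone |t| <= |xi|, where [homogeneous_bound] applies to the N-th derivative
    in t, of degree m - N minus the fiber order of ws. *)
Lemma homogeneous_expansion m v (K : set 'rV[R]_n) N ws : compact K ->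
  smooth punctured1 v -> homogeneous m v ->
  exists2 C : R, 0 < C & forall (x : 'rV[R]_n) (xi : 'rV[R]_d), K x -> 1 <= `|xi| ->
   `|dw (fun p => v (slice 1 p) - \sum_(j < N) tcoef v j p) ws (x, xi)| <=
     C * (1 + `|xi|) `^ (m - N%:R - (fiber_order ws)%:R).
Proof.
move=> cK sv hv; set ws' := map (@slice_index n d) ws.
pose g := dw v (nseq N tindex ++ ws').
have sg : smooth punctured1 g by exact: smooth_dw.
have hg : homogeneous (m - N%:R - (fiber_order ws)%:R) g.
  have := dw_homogeneous (nseq N tindex ++ ws') sv hv.
  rewrite /fiber_order count_cat count_nseq mul1n -[count _ ws']/(fiber_order ws').
  by rewrite slice_index_order natrD opprD addrA.
have [C C0 HC] := homogeneous_bound cK (fun p => smooth_continuous sg) hg.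
set mu := m - N%:R - _ in HC *.
exists (C * 2 `^ `|mu|); first by rewrite mulr_gt0 // powR_gt0.
move=> x xi Kx xi1; have xi0 : 0 < `|xi| by exact: lt_le_trans xi1.
have Pp : punctured (x, xi) by rewrite /punctured /= -normr_gt0.
have P1 t : punctured1 (slice t (x, xi)) by rewrite /punctured1 /preimage /= fproj_slice.
have oP := open_punctured.
rewrite (dwB _ oP) //; [|exact: (smooth_slice 1 sv)|]; last first.
  by apply: smooth_sum => // j; exact: smooth_tcoef.
rewrite (dw_sum _ _ oP) //; last by move=> j; exact: smooth_tcoef.
rewrite -[X in dw X]/(v \o slice 1) (dw_embed (sigma := @slice_index n d)); last first.
  by move=> i h q; exact: slice_affine.
(* With the letters t in front, [F j.+1] is by computation the derivative of [F j] in t. *)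
pose F j t := dw v (nseq j tindex ++ ws') (slice t (x, xi)).
have -> : \sum_(j < N) dw (tcoef v j) ws (x, xi) = \sum_(j < N) (j`!%:R)^-1 * F j 0 * 1 ^+ j.
  by apply: eq_bigr => j _; rewrite expr1n mulr1 tcoef_dw.
rewrite -[X in X - _]/(F 0%N 1).
rewrite -mulrA (le_trans _ (ler_wpM2l (ltW C0) (powR_le_shift mu xi1))) //.
apply: taylor_bound; rewrite ?ler01 ?lexx ?mulr_ge0 ?powR_ge0 ?(ltW C0) //.
  move=> j t _ _; have dF : differentiable (dw v (nseq j tindex ++ ws')) (slice t (x, xi)).
    exact: smooth_differentiable (smooth_dw _ sv) (P1 t).
  have A (h : R) : slice (h *: 1 + t) (x, xi) = h *: bvec tindex + slice t (x, xi).
    rewrite /slice /fiber_pt /tindex /= delta_mx_rshift.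
    rewrite -[RHS]/(_ *: _ + _, _ *: _ + _) scaler0 add0r; congr (_, _).
    rewrite scale_row_mx scaler0 add_row_mx add0r; congr (row_mx _ _).
    by apply/matrixP => i k; rewrite !ord1 !mxE /= [h%:A]mulr1 ?mulr1n ?mulr1.
  apply: DeriveDef.
    apply: (derivable_affine (A := fun t => slice t (x, xi)) A).
    exact: diff_derivable.
  exact: (derive_affine (A := fun t => slice t (x, xi)) _ A).
move=> t /andP[t0 t1]; apply: HC => //.
by rewrite ger0_norm // (le_trans t1).
Qed.

Lemma nat_gt (s : R) : exists N : nat, s <= N%:R.
Proof.
exists (Num.bound `|s|); rewrite (le_trans (ler_norm s)) // ltW //.
by apply: archi_boundP.
Qed.

(** The exponent - M is the same for all derivatives: the error is rapidly decreasing in xi, locally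
    uniformly in x, beyond radius r. *)
Definition slice_approx (r : R) a v := forall (K : set 'rV[R]_n) ws (M : nat),
  compact K -> exists2 C : R, 0 < C &
    forall (x : 'rV[R]_n) (xi : 'rV[R]_d), K x -> r < `|xi| ->
      `|dw (fun p => a p - v (slice 1 p)) ws (x, xi)| <= C * (1 + `|xi|) `^ (- M%:R).

Lemma slice_approx_le r r' a v : r <= r' -> slice_approx r a v -> slice_approx r' a v.
Proof.
move=> rr H K ws M cK; have [C C0 HC] := H K ws M cK; exists C => // x xi Kx xir.
by apply: HC => //; exact: le_lt_trans xir.
Qed.

(** Beyond the radius max r1 1 the cutoff is 1 and the difference splits into a minus the slice of
    v, controlled by [slice_approx] with M large, and the Taylor remainder. Smaller xi are absorbed
    by [dbound_outside]. *)
Lemma expansion_symbol m v a (chi : 'rV[R]_d -> R) (r0 r1 : R) N :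
  smooth punctured1 v -> homogeneous m v -> smooth setT a ->
  0 < r0 -> smooth setT chi -> (forall xi : 'rV[R]_d, `|xi| < r0 -> chi xi = 0) ->
  (forall xi : 'rV[R]_d, r1 < `|xi| -> chi xi = 1) ->
  slice_approx r1 a v ->
  dbound (fun k => m - N%:R - k%:R)
    (fun p => a p - \sum_(j < N) chi p.2 * tcoef v j p).
Proof.
move=> sv hv sa r00 schi chi0 chi1 Hrap.
have oP := open_punctured.
have sct j : smooth setT (fun p => chi p.2 * tcoef v j p).
  by apply: (smooth_cutoff_mul (U := punctured) r00) => //; exact: smooth_tcoef.
apply: (@dbound_outside R n d _ _ (Num.max r1 1)).
  by apply: smoothB; [exact: openT| |exact: smooth_sum openT _] => //.
move=> K ws cK.
have [C C0 HC] := homogeneous_expansion N ws cK sv hv.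
have [M HM] := nat_gt (- (m - N%:R - (fiber_order ws)%:R)).
have [C' C'0 HC'] := Hrap K ws M cK.
exists (C' + C); first exact: addr_gt0.
move=> x xi Kx; rewrite gt_max => /andP[xr1 x1].
set O := [set p : V | Num.max r1 1 < `|p.2|].
have oO : open O by exact: open_norm_snd_gt.
have OP : O `<=` punctured.
  by move=> p; rewrite /O /punctured /= gt_max -normr_gt0 => /andP[_ /(lt_trans _)]; apply.
have Op : O (x, xi) by rewrite /O /= gt_max xr1.
have sv1 : smooth O (v \o slice 1) := smooth_sub OP (smooth_slice 1 sv).
have st j : smooth O (tcoef v j) := smooth_sub OP (smooth_tcoef j sv).
have s1 : smooth O (fun p => a p - v (slice 1 p)).
  by apply: smoothB => //; exact: smooth_sub sa.
have s2 : smooth O (fun p => v (slice 1 p) - \sum_(j < N) tcoef v j p).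
  by apply: smoothB => //; exact: smooth_sum.
rewrite (@dw_ext _ _ _ O _ (fun p => (a p - v (slice 1 p)) + (v (slice 1 p) - \sum_(j < N) tcoef
  v j p))) //; last first.
  move=> q; rewrite /O /= gt_max => /andP[q1 _]; rewrite addrA subrK; congr (_ - _).
  by apply: eq_bigr => j _; rewrite chi1 // mul1r.
rewrite (dwD _ oO) // (le_trans (ler_normD _ _)) // mulrDl lerD //.
  rewrite (le_trans (HC' x xi Kx xr1)) // ler_wpM2l ?(ltW C'0) // wt_le //.
  by rewrite lerNl.
exact: HC x xi Kx (ltW x1).
Qed.

End Homogeneous.

Lemma powRN_le {R : realType} (x y : R) (N : nat) : 0 < x -> x <= y ->
  y `^ (- N%:R) <= x `^ (- N%:R).
Proof.
move=> x0 xy; have y0 : 0 < y by exact: lt_le_trans xy.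
rewrite !powRN lef_pV2 ?posrE ?powR_gt0 //.
by apply: ge0_ler_powR; rewrite ?nnegrE ?ler0n ?(ltW x0) ?(ltW y0).
Qed.

(** * The homogeneous limit along dyadic dilations *)

Section HomogeneousLimit.
Context {R : realType} {n d : nat}.
Local Notation V := ('rV[R]_n * 'rV[R]_d)%type.
Local Notation W := ('rV[R]_n * 'rV[R]_(d + 1))%type.
Local Notation J := ('I_n + 'I_(d + 1))%type.
Local Notation half := (2^-1 : R).
Implicit Types (f u : W -> R).

Lemma smooth_fiber_scale k (f : 'rV[R]_n * 'rV[R]_k -> R) s :
  smooth setT f -> smooth setT (fun p => f (fiber_scale s p)).
Proof.
move=> sf; apply: (@smooth_comp_linear R n k _ (fiber_scale s : {linear ('rV[R]_n *
  'rV[R]_k)%type -> _}) setT setT) => //.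
exact: openT.
Qed.

(** Rescaling costs 2^(-mk), differentiation 2^(ok), and decay of order M gains 2^(-Mk); M >= o - m
    + 1 leaves at most 2^-k. M can be taken above any M0, to keep decay in w as well. *)
Lemma rapid_dyadic m f (K : set 'rV[R]_n) ws (M0 : nat) : compact K -> rapid f ->
  exists M C, [/\ (M0 <= M)%N, 0 < C & forall k x w, K x -> w != 0 ->
    `|2 `^ (- (m * k%:R)) * ((2 ^+ k) ^+ fiber_order ws * dw f ws (fiber_scale (2 ^+ k) (x, w)))|
      <= C * `|w| `^ (- M%:R) * half ^+ k].
Proof.
move=> cK rf; set o := fiber_order ws.
have [M1 HM1] := nat_gt (o%:R - m + 1).
pose M := (M0 + M1)%N; have [C C0 HC] := rf M K ws cK.
exists M, C; split=> //; first exact: leq_addr.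
move=> k x w Kx w0; have nw0 : 0 < `|w| by rewrite normr_gt0.
have k0 : 0 < 2 ^+ k :> R by rewrite exprn_gt0.
rewrite !normrM ger0_norm ?powR_ge0 // [X in _ * (X * _)]ger0_norm ?exprn_ge0 //.
apply: (@le_trans _ _ (2 `^ (- (m * k%:R)) * ((2 ^+ k) ^+ o * (C * (2 ^+ k * `|w|) `^ (-
  M%:R))))).
  rewrite ler_wpM2l ?powR_ge0 // ler_wpM2l ?exprn_ge0 //.
  rewrite (le_trans (HC x _ Kx)) // ler_wpM2l ?(ltW C0) //= normrZ ger0_norm ?(ltW k0) //.
  by apply: powRN_le; rewrite ?mulr_gt0 // lerDr.
rewrite powRM ?(ltW k0) ?(ltW nw0) //.
have two (s : R) : (2 ^+ k) `^ s = 2 `^ (k%:R * s) by rewrite -powR_mulrn // powRrM.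
rewrite -(powR_mulrn _ (ltW k0)) !two -[half ^+ k]powR_mulrn ?invr_ge0 // -powR_inv1 // -powRrM.
set A := 2 `^ (- (m * k%:R)); set B := 2 `^ (k%:R * o%:R); set D := 2 `^ (k%:R * - M%:R).
set E := `|w| `^ _; set F := 2 `^ (-1 * k%:R).
have -> : A * (B * (C * (D * E))) = C * E * (A * B * D) by ring.
rewrite ler_wpM2l ?mulr_ge0 ?powR_ge0 ?(ltW C0) //.
have nz : (2 : R) != 0 by [].
rewrite /A /B /D /F -!powRD ?nz ?implybT // ler_powR ?ler1n //.
have -> : - (m * k%:R) + k%:R * o%:R + k%:R * - M%:R = (o%:R - m - M%:R) * k%:R by ring.
have MM : (M1%:R : R) <= M%:R by rewrite ler_nat leq_addl.
rewrite ler_wpM2r // -subr_ge0.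
have -> : -1 - (o%:R - m - M%:R) = (M1%:R - (o%:R - m + 1)) + (M%:R - M1%:R) by ring.
by rewrite addr_ge0 // subr_ge0.
Qed.


(* v is the limit of 2^(-mk) u(x, 2^k w), written as u plus a telescoping series
   of rescaled copies of u(x, 2 w) - 2^m u(x, w). *)
Lemma homogeneous_limit m u : smooth setT u ->
  (forall s : R, 0 < s -> rapid (fun p => u (fiber_scale s p) - s `^ m * u p)) ->
  exists v, [/\ smooth punctured1 v, homogeneous m v &
    slice_approx 1 (fun p => u (slice 1 p)) v].
Proof.
move=> su hu.
pose f s p := u (fiber_scale s p) - s `^ m * u p.
have sf s : smooth setT (f s).
  apply: smoothB; [exact: openT|exact: smooth_fiber_scale|].
  by apply: smoothZ; first exact: openT.
pose g k p := 2 `^ (- m) * (2 `^ (- (m * k%:R)) * f 2 (fiber_scale (2 ^+ k) p)).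
have oP := @open_punctured1 R n d.
have sgT k : smooth setT (g k).
  by do 2 (apply: smoothZ; first exact: openT); exact: smooth_fiber_scale.
have dg k ws p : dw (g k) ws p = 2 `^ (- m) * (2 `^ (- (m * k%:R)) *
    ((2 ^+ k) ^+ fiber_order ws * dw (f 2) ws (fiber_scale (2 ^+ k) p))).
  have sfs := smooth_fiber_scale (2 ^+ k) (sf 2).
  rewrite (dwZ _ _ openT) //; last by apply: smoothZ; first exact: openT.
  by rewrite (dwZ _ _ openT) // (dw_fiber_scale _ openT).
have gb (K : set 'rV[R]_n) ws M0 : compact K -> exists M C, [/\ (M0 <= M)%N, 0 < C &
   forall k x w, K x -> w != 0 ->
    `|dw (g k) ws (x, w)| <= C * `|w| `^ (- M%:R) * half ^+ k].
  move=> cK; have [M [C [MM C0 HC]]] := rapid_dyadic m ws M0 cK (hu 2 (ltr0Sn _ _)).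
  exists M, (2 `^ (- m) * C); split=> //; first by rewrite mulr_gt0 // powR_gt0.
  move=> k x w Kx w0; rewrite dg normrM ger0_norm ?powR_ge0 // -!mulrA.
  by rewrite ler_wpM2l ?powR_ge0 // [leRHS]mulrA; exact: HC.
have w_neq0 (p : W) : punctured1 p -> p.2 != 0.
  by apply: contraNneq => p0; rewrite /fproj /= p0 raddf0.
have geo : geo_smooth (@punctured1 R n d) g.
  split=> [k|ws p Pp]; first exact: smooth_sub (sgT k).
  have cB : compact [set y : 'rV[R]_n | `|y| <= `|p.1| + 1].
    by apply: (@compact_row_ball _ _ (`|p.1| + 1)) => //; exact: closed_norm_le.
  have [M [C [_ C0 HC]]] := gb _ ws 0%N cB.
  have w0 : 0 < `|p.2| by rewrite normr_gt0 w_neq0.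
  have w20 : 0 < `|p.2| / 2 by rewrite divr_gt0.
  (* Near p the fiber norm stays above |p.2| / 2, which bounds |w|^-M locally. *)
  exists (C * (`|p.2| / 2) `^ (- M%:R)), 0%N.
  split; first by rewrite mulr_ge0 ?powR_ge0 // ltW.
  have n1 : \forall q \near p, `|q.2| > `|p.2| / 2.
    have oq := @open_norm_snd_gt R n (d + 1) (`|p.2| / 2).
    by apply: (open_nbhs_nbhs (conj oq _)); rewrite /= ltr_pdivrMr // ltr_pMr // ltr1n.
  have n2 : \forall q \near p, `|q.1| < `|p.1| + 1.
    have := @cvgr_lt R _ (nbhs p) _ (fun q : W => `|q.1|) `|p.1|.
    apply; last by rewrite ltrDl.
    apply: (continuous_comp (f := fst) (g := fun w : 'rV[R]_n => `|w|)).
      exact: cvg_fst.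
    exact: norm_continuous.
  apply: filterS2 n1 n2 => -[x w] /= wp xp k _.
  have w'0 : 0 < `|w| by exact: lt_trans wp.
  rewrite (le_trans (HC k x w (ltW xp) _)) -?normr_gt0 // ler_wpM2r ?half_ge0 //.
  by rewrite ler_wpM2l ?(ltW C0) // powRN_le // ltW.
have cg p : punctured1 p -> cvgn (series (fun k => g k p)).
  move=> Pp; have [C [K [C0 /nbhs_singleton H]]] := geo.2 [::] p Pp.
  by have [] := geo_tail C0 H.
have tele p j : u p + series (fun k => g k p) j = 2 `^ (- (m * j%:R)) * u (fiber_scale (2 ^+ j)
  p).
  elim: j => [|j IH].
    by rewrite mulr0 oppr0 powRr0 mul1r /series /= big_geq // addr0 expr0 /fiber_scale scale1r;
      case: p.
  rewrite seriesSr addrA IH /g /f.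
  have -> : fiber_scale 2 (fiber_scale (2 ^+ j) p) = fiber_scale (2 ^+ j.+1) p.
    by rewrite /fiber_scale /= scalerA -exprS.
  have -> : 2 `^ (- (m * j.+1%:R)) = 2 `^ (- m) * 2 `^ (- (m * j%:R)).
    rewrite -powRD; last by apply/implyP.
    by congr (_ `^ _); rewrite -natr1; ring.
  have E : 2 `^ (- m) * 2 `^ m = 1 :> R.
    by rewrite -powRD ?addNr ?powRr0 //; apply/implyP.
  set a := 2 `^ (- m) in E *; set b := 2 `^ m in E *; set c := 2 `^ _.
  set y := u (fiber_scale (2 ^+ j) p).
  rewrite mulrA mulrBr [X in _ - X]mulrA (_ : a * c * b = c * (a * b)); last by ring.
  by rewrite E mulr1; ring.
pose v p := u p + ssum g p.
have vlim p : punctured1 p ->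
    (fun j => 2 `^ (- (m * j%:R)) * u (fiber_scale (2 ^+ j) p)) @ \oo --> v p.
  move=> Pp; rewrite -(funext (tele p)); apply: cvgD; first exact: cvg_cst.
  exact: cg.
have sP : smooth punctured1 (ssum g) by exact: smooth_ssum.
have suP : smooth punctured1 u by exact: smooth_sub su.
exists v; split.
- exact: smoothD.
(* Dilations commute, so v (s p) - s^m v p is the limit of 2^(-mj) f s (2^j p). The rapid decay of
   the defect f s makes this limit 0. *)
- move=> p s s0 Pp; apply/eqP; rewrite -subr_eq0; apply/eqP.
  have Psp := punctured1_scale s0 Pp.
  have L1 : (fun j => 2 `^ (- (m * j%:R)) * f s (fiber_scale (2 ^+ j) p)) @ \oo -->
      v (fiber_scale s p) - s `^ m * v p.
    have -> : (fun j => 2 `^ (- (m * j%:R)) * f s (fiber_scale (2 ^+ j) p)) =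
       (fun j => 2 `^ (- (m * j%:R)) * u (fiber_scale (2 ^+ j) (fiber_scale s p)) -
          s `^ m * (2 `^ (- (m * j%:R)) * u (fiber_scale (2 ^+ j) p))).
      apply/funext => j; rewrite /f mulrBr mulrCA; congr (_ * u _ - _).
      by rewrite /fiber_scale /= !scalerA mulrC.
    by apply: cvgB; [exact: vlim|apply: cvgMl_tmp; exact: vlim].
  have cB : compact [set y : 'rV[R]_n | `|y| <= `|p.1|].
    by apply: (@compact_row_ball _ _ (`|p.1|)) => //; exact: closed_norm_le.
  have [M [C [_ C0 HC]]] := rapid_dyadic m [::] 0%N cB (hu s s0).
  have C'0 : 0 <= C * `|p.2| `^ (- M%:R) by rewrite mulr_ge0 ?powR_ge0 // ltW.
  have L2 : (fun j => 2 `^ (- (m * j%:R)) * f s (fiber_scale (2 ^+ j) p)) @ \oo --> (0 : R).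
    set q := (fun j => _).
    have [|cs _] := @geo_tail R q _ 0%N C'0; last exact: cvg_series_cvg_0.
    move=> k _; have := HC k p.1 p.2 (lexx _) (w_neq0 _ Pp); rewrite mul1r.
    by rewrite -surjective_pairing.
  exact: (cvg_unique _ L1 L2).
(* Here u - v = - [ssum g], and the whole series is bounded by 2 C |w|^-M at w = (xi, 1), where |w|
   >= |xi|. The factor 2^M comes from replacing |xi| by 1 + |xi|. *)
- move=> K ws M0 cK.
  have [M [C [MM C0 HC]]] := gb K (map (@slice_index n d) ws) M0 cK.
  exists (2 * C * 2 `^ M%:R); first by rewrite !mulr_gt0 // powR_gt0.
  move=> x xi Kx xi1; have xi0 : 0 < `|xi| by exact: lt_trans xi1.
  have Pp : punctured (x, xi) by rewrite /punctured /= -normr_gt0.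
  have P1 : punctured1 (slice 1 (x, xi)) by rewrite /punctured1 /preimage /= fproj_slice.
  have -> : (fun p => u (slice 1 p) - v (slice 1 p)) = (fun p => (-1) * (ssum g \o slice 1) p).
    by apply/funext => p; rewrite /v /= opprD addrA subrr add0r mulN1r.
  rewrite (dwZ _ _ (@open_punctured R n d)) //; last exact: smooth_slice.
  rewrite mulN1r normrN (dw_embed (sigma := @slice_index n d)); last first.
    by move=> i h q; exact: slice_affine.
  rewrite /= (dw_ssum _ oP geo) // /ssum.
  have w0 : 0 < `|fiber_pt xi 1| by apply: lt_le_trans (norm_le_fiber_pt _ _).
  have C'0 : 0 <= C * `|fiber_pt xi 1| `^ (- M%:R) by rewrite mulr_ge0 ?powR_ge0 // ltW.
  have [_] := @geo_tail R (fun k => dw (g k) (map (@slice_index n d) ws) (slice 1 (x, xi))) _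
    0%N C'0
     (fun k _ => HC k x (fiber_pt xi 1) Kx (w_neq0 _ P1)).
  rewrite expr0 mulr1 {2}/series /= big_geq // subr0 => /le_trans; apply.
  rewrite -!mulrA ler_wpM2l // ler_wpM2l ?(ltW C0) //.
  apply: (@le_trans _ _ (`|xi| `^ (- M%:R))).
    by rewrite powRN_le // norm_le_fiber_pt.
  rewrite (le_trans (powR_le_shift _ (ltW xi1))) // normrN ger0_norm ?ler0n //.
  by rewrite ler_wpM2l ?powR_ge0 // wt_le // lerN2 ler_nat.
Qed.

End HomogeneousLimit.

(** * Borel summation *)

Section Cutoffs.
Context {R : realType} {d : nat}.
Implicit Types (xi : 'rV[R]_d) (t s : R).

(** The sup norm is not smooth, so cutoffs are built from the squared Euclidean norm. *)
Definition sqnorm xi : R := \sum_i xi 0 i ^+ 2.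

Lemma sqnorm_ge0 xi : 0 <= sqnorm xi.
Proof. by rewrite sumr_ge0 // => i _; exact: sqr_ge0. Qed.

Lemma sqnormZ s xi : sqnorm (s *: xi) = s ^+ 2 * sqnorm xi.
Proof. by rewrite /sqnorm mulr_sumr; apply: eq_bigr => i _; rewrite mxE exprMn. Qed.

Lemma norm_sqr_le_sqnorm xi : `|xi| ^+ 2 <= sqnorm xi.
Proof.
rewrite -(sqr_sqrtr (sqnorm_ge0 xi)) ler_sqr ?nnegrE ?sqrtr_ge0 //.
apply: norm_row_le; first exact: sqrtr_ge0.
move=> j; rewrite -sqrtr_sqr ler_wsqrtr // /sqnorm (bigD1 j) //= lerDl.
by rewrite sumr_ge0 // => i _; exact: sqr_ge0.
Qed.

Lemma sqnorm_le xi : sqnorm xi <= d%:R * `|xi| ^+ 2.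
Proof.
apply: (@le_trans _ _ (\sum_(i < d) `|xi| ^+ 2)).
  by apply: ler_sum => i _; rewrite -real_normK ?num_real // ler_sqr ?nnegrE // norm_entry.
by rewrite sumr_const card_ord mulr_natl.
Qed.

Lemma sqnorm_gt0 xi : xi != 0 -> 0 < sqnorm xi.
Proof.
by move=> xi0; apply: lt_le_trans (norm_sqr_le_sqnorm xi); rewrite exprn_gt0 // normr_gt0.
Qed.

Lemma smooth_sqnorm : smooth setT sqnorm.
Proof.
apply: smooth_sum => [|i k]; first exact: openT.
apply: Ck_onX; first exact: openT.
have lin : linear (fun xi : 'rV[R]_d => xi 0 i) by move=> a u v; rewrite !mxE.
pose L : {linear 'rV[R]_d -> R} := HB.pack (fun xi : 'rV[R]_d => xi 0 i)
  (GRing.isLinear.Build _ _ _ _ _ lin).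
by apply: (@Ck_on_linear _ _ k setT L) => xi; exact: coord_continuous.
Qed.

(** Despite the name it vanishes near 0 and is 1 far away: it is a particular choice of the cutoff
    chi. *)
Definition bump xi : R := 1 - smooth_step (sqnorm xi).

Lemma smooth_bump : smooth setT bump.
Proof.
apply: smoothB; [exact: openT|move=> k; exact: Ck_on_cst|].
by apply: smooth_comp1; [exact: openT|exact: smooth_smooth_step|exact: smooth_sqnorm].
Qed.

(** The radius 1/(d+1) gives sqnorm <= d/(d+1)^2 <= 1, and makes sense for d = 0. *)
Lemma bump0 xi : `|xi| < d.+1%:R^-1 -> bump xi = 0.
Proof.
move=> xid; rewrite /bump smooth_step1 ?subrr // (le_trans (sqnorm_le _)) //.
have d0 : 0 < d.+1%:R :> R by rewrite ltr0n.
apply: (@le_trans _ _ (d.+1%:R * (d.+1%:R^-1 * d.+1%:R^-1))).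
  rewrite ler_pM ?sqr_ge0 ?ler_nat // expr2 ler_pM // ltW //.
by rewrite mulrA divff ?gt_eqF // mul1r invf_le1 // ler1n.
Qed.

Lemma bump1 xi : 2 < `|xi| -> bump xi = 1.
Proof.
move=> xi2; rewrite /bump smooth_step0 ?subr0 // (le_trans _ (norm_sqr_le_sqnorm _)) //.
rewrite expr2 (le_trans (ltW xi2)) // ler_peMl // ltW // (lt_trans _ xi2) //.
by rewrite ltr1n.
Qed.

End Cutoffs.

Lemma fiber_scale_tscale {R : realType} {n d : nat} (s c : R) (p : 'rV[R]_n * 'rV[R]_(d + 1)) :
  tscale c (fiber_scale s p) = fiber_scale s (tscale c p).
Proof.
by rewrite (slice_surj p) fiber_scale_slice !tscale_slice fiber_scale_slice mulrCA.
Qed.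

(** * A homogeneous function with prescribed Taylor coefficients in t *)

Section Borel.
Context {R : realType} {n d : nat}.
Local Notation V := ('rV[R]_n * 'rV[R]_d)%type.
Local Notation W := ('rV[R]_n * 'rV[R]_(d + 1))%type.
Local Notation J := ('I_n + 'I_(d + 1))%type.
Local Notation half := (2^-1 : R).
Variables (m : R) (a : nat -> V -> R).
Hypothesis sa : forall j, smooth punctured (a j).
Hypothesis ha : forall j p (s : R), 0 < s -> punctured p ->
  a j (fiber_scale s p) = s `^ (m - j%:R) * a j p.

Let sq (p : W) : R := sqnorm (fproj p).2.

Let smooth_sq (U : set W) : smooth U sq.
Proof.
apply: (@smooth_sub _ _ setT) => //.
apply: (@smooth_comp_linear R n (d + 1) _ (fproj : {linear W -> V}) setT setT (fun p : V =>
  sqnorm p.2)) => //.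
  exact: openT.
apply: (@smooth_comp_linear R n d _ (snd : {linear V -> 'rV[R]_d}) setT setT) => //.
  exact: openT.
exact: smooth_sqnorm.
Qed.

Let smooth_tcoord (U : set W) : smooth U tcoord.
Proof. exact: (@smooth_linear R n (d + 1) (tcoord : {linear W -> R}) U). Qed.

Let smooth_quad (c : R) : smooth setT (fun p => sq p - c * tcoord p ^+ 2).
Proof.
apply: smoothB; [exact: openT|exact: smooth_sq|].
apply: smoothZ; first exact: openT.
by move=> k; apply: Ck_onX; [exact: openT|exact: smooth_tcoord].
Qed.

Let open_quad (c : R) (O : set R) : open O -> open ((fun p => sq p - c * tcoord p ^+ 2) @^-1` O).
Proof.
move=> oO; apply: open_comp => // p _.
exact: (smooth_continuous (smooth_quad c) (Logic.I : setT p)).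
Qed.

(** The monomial a_j t^j is cut off by a function of t^2 / |xi|^2. This factor has degree 0, so the
    term keeps degree m; it is 1 near t = 0, so the Taylor coefficients survive; it vanishes for t^2
    >= 2 |xi|^2. *)
Definition borel_term j (p : W) : R :=
  a j (fproj p) * tcoord p ^+ j * smooth_step (tcoord p ^+ 2 / sq p).

Lemma smooth_borel_term j : smooth punctured1 (borel_term j).
Proof.
have oP := @open_punctured1 R n d.
have sX k : smooth (@punctured1 R n d) (fun p => tcoord p ^+ k).
  by move=> l; apply: Ck_onX => //; exact: smooth_tcoord.
apply: smoothM => //.
  apply: smoothM => //.
  exact: (@smooth_comp_linear R n (d + 1) _ (fproj : {linear W -> V}) punctured1 punctured).
apply: (smooth_comp1 oP smooth_smooth_step).
apply: smoothM => // k; apply: Ck_onV => //; last exact: smooth_sq.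
by move=> q Pq; rewrite gt_eqF // sqnorm_gt0.
Qed.

Lemma borel_term_scale j s p : 0 < s -> punctured1 p ->
  borel_term j (fiber_scale s p) = s `^ m * borel_term j p.
Proof.
move=> s0 Pp; rewrite /borel_term /sq fproj_fiber_scale ha //.
have -> : tcoord (fiber_scale s p) = s * tcoord p by rewrite /tcoord /= mxE.
rewrite /= sqnormZ -/(sq p) !exprMn -mulf_div divff ?mul1r; last first.
  by rewrite expf_neq0 // gt_eqF.
have -> : s `^ m = s `^ (m - j%:R) * s ^+ j.
  rewrite -powR_mulrn ?ltW // -powRD ?subrK //.
  by apply/implyP => _; rewrite gt_eqF.
ring.
Qed.

Lemma dw_borel_term0 j ws p : punctured1 p -> 2 * sq p < tcoord p ^+ 2 ->
  dw (borel_term j) ws p = 0.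
Proof.
move=> Pp tp.
pose O := punctured1 `&` ((fun p => sq p - half * tcoord p ^+ 2) @^-1` [set y : R | y < 0]).
have oO : open O.
  by apply: openI; [exact: open_punctured1|apply: open_quad; exact: open_lt].
have hE q : sq q - half * tcoord q ^+ 2 < 0 <-> 2 * sq q < tcoord q ^+ 2.
  by split => H; lra.
rewrite -(dw0 ws p); apply: (dw_ext _ oO) => [q [Pq /hE tq]|]; last by split => //; exact/hE.
rewrite /borel_term smooth_step0 ?mulr0 // ler_pdivlMr ?ltW //.
exact: sqnorm_gt0.
Qed.

(** An exhaustion of [punctured]: every point has a neighbourhood contained in all shells of large
    index, so it is enough to control the j-th term on the j-th shell. *)
Let shell (j : nat) (p : V) := [/\ `|p.1| <= j%:R, j.+1%:R^-1 <= `|p.2| & `|p.2| <= j%:R].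

(** A shell bounds x and xi but not t. Where t^2 > 2 [sq] the derivative is 0; the remaining t
    satisfy t^2 <= 2 d j^2 <= (2 (d + 1) j)^2 and range over a compact set. *)
Lemma borel_term_bound j ws : exists2 C : R, 0 < C &
  forall p : W, shell j (fproj p) -> `|dw (borel_term j) ws p| <= C.
Proof.
pose B : set 'rV[R]_(d + 1) := [set w | j.+1%:R^-1 <= `|lsubmx w|] `&`
  [set w | `|w| <= 2 * d.+1%:R * j%:R].
have cB : compact B.
  apply: (@compact_row_ball _ _ (2 * d.+1%:R * j%:R)); last by move=> w [].
  apply: closedI; last exact: closed_norm_le.
  apply: (@preimage_closed _ _ (fun w : 'rV[R]_(d + 1) => `|lsubmx w|) [set y : R | j.+1%:R^-1
    <= y]).
    move=> w _; apply: (continuous_comp (f := lsubmx) (g := fun z : 'rV[R]_d => `|z|)).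
      exact: continuous_lsubmx.
    exact: norm_continuous.
  exact: closed_ge.
have cA : compact [set x : 'rV[R]_n | `|x| <= j%:R].
  by apply: (@compact_row_ball _ _ j%:R) => //; exact: closed_norm_le.
have [|C C0 HC] := compact_bounded_fun (f := dw (borel_term j) ws) (compact_setX cA cB).
  move=> [x w] [_ [/= w1 _]]; apply: (smooth_continuous (smooth_dw ws (smooth_borel_term j))).
  by rewrite /punctured1 /preimage /punctured /= -normr_gt0 (lt_le_trans _ w1) // invr_gt0.
exists C => // p [p1 p2 p3].
have Pp : punctured1 p.
  by rewrite /punctured1 /preimage /punctured /= -normr_gt0 (lt_le_trans _ p2) // invr_gt0.
have [tp|tp] := ltP (2 * sq p) (tcoord p ^+ 2); first by rewrite dw_borel_term0 // normr0 ltW.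
apply: HC; split; first exact: p1.
split; first exact: p2.
apply: norm_fiber_le.
  by rewrite (le_trans p3) // ler_peMl // mulr_ege1 // ler1n.
have j0 : 0 <= 2 * d.+1%:R * j%:R :> R by rewrite !mulr_ge0.
rewrite -ler_sqr ?nnegrE // real_normK ?num_real // (le_trans tp) //.
apply: (@le_trans _ _ (2 * (d%:R * j%:R ^+ 2))).
  rewrite ler_wpM2l // (le_trans (sqnorm_le _)) // ler_wpM2l // ler_sqr ?nnegrE //.
rewrite !exprMn mulrA ler_wpM2r ?sqr_ge0 // expr2 -mulrA ler_wpM2l //.
rewrite -natrX -natrM ler_nat (leq_trans (leqnSn d)) // expnS expn1 mulnA.
exact: leq_pmull.
Qed.

Let fproj_tscale c (p : W) : fproj (tscale c p) = fproj p.
Proof. by rewrite /fproj /tscale /= row_mxKl. Qed.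

Let tcoord_tscale c (p : W) : tcoord (tscale c p) = c * tcoord p.
Proof. by rewrite [in LHS](slice_surj p) tscale_slice tcoord_slice. Qed.

(* Rescaling t alone leaves the coefficient of t^j unchanged, while derivatives
   of order < j gain a factor 1/c. *)
Definition borel_summand (c : R) j (p : W) : R := c^-1 ^+ j * borel_term j (tscale c p).

Lemma smooth_borel_summand c j : smooth punctured1 (borel_summand c j).
Proof.
have oP := @open_punctured1 R n d.
apply: smoothZ => //.
apply: (@smooth_comp_linear R n (d + 1) _ (tscale c : {linear W -> W}) punctured1 punctured1) =>
  //.
  by move=> p Pp; rewrite /punctured1 /preimage /= fproj_tscale.
exact: smooth_borel_term.
Qed.

(** Each letter brings out at most one factor c, and c^-j c^(size ws) <= 1/c since size ws < j. *)
Lemma dw_borel_summand_le c j ws p C : 1 <= c -> (size ws < j)%N -> punctured1 p ->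
  `|dw (borel_term j) ws (tscale c p)| <= C -> `|dw (borel_summand c j) ws p| <= C / c.
Proof.
move=> c1 wsj Pp HC; have c0 : 0 < c by exact: lt_le_trans c1.
have oP := @open_punctured1 R n d.
have Ptp : punctured1 (tscale c p) by rewrite /punctured1 /preimage /= fproj_tscale.
have sT : smooth punctured1 (fun p => borel_term j (tscale c p)).
  apply: (@smooth_comp_linear R n (d + 1) _ (tscale c : {linear W -> W}) punctured1 punctured1)
    => //.
    by move=> q Pq; rewrite /punctured1 /preimage /= fproj_tscale.
  exact: smooth_borel_term.
rewrite (dwZ _ _ oP) // -[X in dw X]/(borel_term j \o tscale c).
have -> := @dw_diag R n (d + 1) (tscale c : {linear W -> W}) _ punctured1 (borel_term j) ws
  (@tscale_bvec R n d c) oP (smooth_borel_term j) p Ptp.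
have ic0 : 0 <= c^-1 by rewrite invr_ge0 ltW.
have cw0 : 0 <= \prod_(i <- ws) (if i == tindex then c else 1).
  by apply: prodr_ge0 => i _; case: ifP; rewrite ?ltW.
rewrite !normrM ger0_norm ?exprn_ge0 // (ger0_norm cw0).
apply: (@le_trans _ _ (c^-1 ^+ j * (c ^+ size ws * C))).
  rewrite ler_wpM2l ?exprn_ge0 // ler_pM //.
  elim: ws {wsj HC cw0} => [|i ws IH]; first by rewrite big_nil expr0.
  rewrite big_cons exprS ler_pM //; first by case: ifP; rewrite ?ltW.
    by apply: prodr_ge0 => k _; case: ifP; rewrite ?ltW.
  by case: ifP.
rewrite mulrA mulrC ler_wpM2l ?(le_trans (normr_ge0 _) HC) //.
rewrite -(subnKC wsj) exprD exprS; set b := c^-1 ^+ size ws; set w := c ^+ size ws.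
have bw : b * w = 1 by rewrite -exprMn mulVf ?expr1n // gt_eqF.
rewrite -[_ * w]mulrAC -[_ * b * w]mulrA bw mulr1 ler_piMr //.
by rewrite exprVn invf_le1 ?exprn_gt0 // exprn_ege1.
Qed.

(** Where c^2 t^2 < [sq], a neighbourhood of the slice t = 0, the cutoff is 1 and the powers of c
    cancel: the summand is a_j t^j there. *)
Lemma dw_borel_summand_slice0 c j i p : 1 <= c -> punctured p ->
  dw (borel_summand c j) (nseq i tindex) (slice 0 p) = if i == j then i`!%:R * a i p else 0.
Proof.
move=> c1 Pp; have c0 : 0 < c by exact: lt_le_trans c1.
have oP := @open_punctured1 R n d.
pose O := punctured1 `&` ((fun p => sq p - c ^+ 2 * tcoord p ^+ 2) @^-1` [set y : R | 0 < y]).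
have oO : open O by apply: openI => //; apply: open_quad; exact: open_gt.
have P0 : punctured1 (slice 0 p) by rewrite /punctured1 /preimage /= fproj_slice.
have Op : O (slice 0 p).
  split=> //=; rewrite tcoord_slice expr0n mulr0 subr0 /sq fproj_slice.
  exact: sqnorm_gt0.
rewrite (@dw_ext _ _ _ O _ (fun q => a j (fproj q) * (fun y => y ^+ j) (tcoord q))) //; last
  first.
  move=> q [Pq /= tq]; have q0 := sqnorm_gt0 Pq.
  rewrite /borel_summand /borel_term fproj_tscale tcoord_tscale smooth_step1.
    rewrite mulr1 exprMn mulrCA; congr (_ * _).
    by rewrite mulrA -exprMn mulVf ?expr1n ?mul1r // gt_eqF.
  rewrite /sq fproj_tscale ler_pdivrMr // mul1r exprMn.
  by move: tq; rewrite subr_gt0 => /ltW.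
have sX k : smooth setT (fun y : R => y ^+ k).
  move=> l; apply: Ck_onX; first exact: openT.
  by apply: (@Ck_on_linear _ _ l setT (idfun : {linear R -> R})) => x; exact: cvg_id.
rewrite (dw_tensor _ (@open_punctured R n d) (sa j) (sX j) P0) fproj_slice tcoord_slice.
have bt : base_index (@tindex n d) = None.
  by rewrite /base_index /tindex; case: split_ordP => // k /eqP; rewrite eq_rlshift.
have -> : base_word (nseq i (@tindex n d)) = [::].
  by elim: (i) (tindex) bt => //= k IH ti bt; rewrite /base_word /= bt; exact: IH.
have -> : torder (nseq i (@tindex n d)) = i.
  by rewrite /torder count_nseq bt mul1n.
have -> k : iter k D1 (fun y : R => y ^+ j) = fun y => (j ^_ k)%:R * y ^+ (j - k).
  elim: k => [|k IH]; first by apply/funext => y; rewrite /= subn0 mul1r.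
  rewrite iterS IH; apply/funext => y; rewrite /D1 deriveMl; last exact: exprn_derivable.
  by rewrite exp_derive scaler1 ffactnSr natrM -mulrA subnS.
rewrite expr0n /=; case: (ltngtP i j) => [ij|ij|->].
- by rewrite subn_eq0 leqNgt ij /= !mulr0.
- by rewrite ffact_small // mul0r mulr0.
- by rewrite subnn /= ffactnn mulr1 mulrC.
Qed.

Lemma borel : exists v, [/\ smooth punctured1 v, homogeneous m v,
  forall i p, punctured p -> tcoef v i p = a i p &
  forall p, punctured1 p -> 2 * sqnorm (fproj p).2 <= tcoord p ^+ 2 -> v p = 0].
Proof.
have oP := @open_punctured1 R n d.
have /choice[Cw HCw] : forall x : nat * seq J, exists C : R, 0 < C /\
    forall p : W, shell x.1 (fproj p) -> `|dw (borel_term x.1) x.2 p| <= C.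
  by move=> [j ws]; have [C C0 HC] := borel_term_bound j ws; exists C.
(* The scale of the j-th term controls the finitely many words of code <= j, so
   each word is eventually controlled. *)
pose Cs j : R := \sum_(i < j.+1) oapp (fun ws => Cw (j, ws)) 0 (unpickle i).
have term_ge0 j i : 0 <= oapp (fun ws : seq J => Cw (j, ws)) 0 (unpickle i).
  by case: unpickle => //= ws; rewrite ltW //; exact: (HCw _).1.
have Cs0 j : 0 <= Cs j by apply: sumr_ge0.
(* Against a bound Cs j + 1 for the term, the gain 1 / l j leaves exactly 2^-j. *)
pose l j : R := 2 ^+ j * (Cs j + 1).
have l1 j : 1 <= l j.
  by rewrite /l mulr_ege1 ?exprn_ege1 ?ler1n // lerDr.
pose g j := borel_summand (l j) j.
have gbound j ws p : (pickle ws <= j)%N -> (size ws < j)%N -> shell j (fproj p) ->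
    `|dw (g j) ws p| <= half ^+ j.
  move=> wj sj shp.
  have Pp : punctured1 p.
    have [_ p2 _] := shp.
    by rewrite /punctured1 /preimage /punctured /= -normr_gt0 (lt_le_trans _ p2) // invr_gt0.
  have H : `|dw (borel_term j) ws (tscale (l j) p)| <= Cs j + 1.
    apply: (@le_trans _ _ (Cw (j, ws))).
      by apply: (HCw (j, ws)).2; rewrite fproj_tscale.
    rewrite ler_wpDr //; pose i0 : 'I_j.+1 := Ordinal (wj : (pickle ws < j.+1)%N).
    have -> : Cw (j, ws) = oapp (fun ws => Cw (j, ws)) 0 (unpickle i0) by rewrite pickleK.
    by rewrite /Cs (bigD1 i0) // lerDl sumr_ge0.
  rewrite (le_trans (dw_borel_summand_le (l1 j) sj Pp H)) // /l invfM mulrCA divff ?mulr1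
    ?exprVn //.
  by rewrite gt_eqF // ltr_wpDl.
have geo : geo_smooth (@punctured1 R n d) g.
  split=> [j|ws p Pp]; first exact: smooth_borel_summand.
  have xi0 : 0 < `|(fproj p).2| by rewrite normr_gt0.
  have xi20 : 0 < `|(fproj p).2| / 2 by rewrite divr_gt0.
  have [K1 HK1] := nat_gt (`|p.1| + 1).
  have [K2 HK2] := nat_gt (`|(fproj p).2| + 1).
  have [K3 HK3] := nat_gt (`|(fproj p).2| / 2)^-1.
  (* The first two summands ensure that j controls the word ws. K1 and K2 bound x and xi from above
     near p, and K3 bounds |xi| from below, so that nearby points lie in the j-th shell. *)
  exists 1, (pickle ws + (size ws).+1 + K1 + K2 + K3)%N; split=> //.
  have n1 : \forall q \near p, `|q.1| < `|p.1| + 1.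
    have := @cvgr_lt R _ (nbhs p) _ (fun q : W => `|q.1|) `|p.1|.
    apply; last by rewrite ltrDl.
    apply: (continuous_comp (f := fst) (g := fun w : 'rV[R]_n => `|w|)).
      exact: cvg_fst.
    exact: norm_continuous.
  have n2 : \forall q \near p, `|(fproj q).2| < `|(fproj p).2| + 1.
    have oq := open_fproj (@open_norm_snd_lt R n d (`|(fproj p).2| + 1)).
    by apply: (open_nbhs_nbhs (conj oq _)); rewrite /preimage /= ltrDl.
  have n3 : \forall q \near p, `|(fproj p).2| / 2 < `|(fproj q).2|.
    have oq := open_fproj (@open_norm_snd_gt R n d (`|(fproj p).2| / 2)).
    by apply: (open_nbhs_nbhs (conj oq _)); rewrite /preimage /= ltr_pdivrMr // ltr_pMr // ltr1n.
  apply: filterS3 n1 n2 n3 => q q1 q2 q3 j Kj; rewrite mul1r.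
  have le_nat (x : R) (K : nat) : x <= K%:R -> (K <= j)%N -> x <= j%:R.
    by move=> xK KK; rewrite (le_trans xK) // ler_nat.
  have [k1 k2 k3 k4 k5] : [/\ (pickle ws <= j)%N, (size ws < j)%N, (K1 <= j)%N, (K2 <= j)%N &
    (K3 <= j)%N].
    by clear - Kj; move: (pickle ws) (size ws) Kj => A B Kj; split; lia.
  apply: gbound => //; split.
  - exact: le_trans (ltW q1) (le_nat _ _ HK1 k3).
  - rewrite (le_trans _ (ltW q3)) // -[leRHS]invrK lef_pV2 ?posrE ?ltr0n ?invr_gt0 //.
    by rewrite (le_trans (le_nat _ _ HK3 k5)) // ler_nat.
  - exact: le_trans (ltW q2) (le_nat _ _ HK2 k4).
have cg ws p : punctured1 p -> cvgn (series (fun j => dw (g j) ws p)).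
  move=> Pp; have [C [K [C0 /nbhs_singleton H]]] := geo.2 ws p Pp.
  by have [] := geo_tail C0 H.
exists (ssum g); split.
- exact: smooth_ssum.
- move=> p s s0 Pp; apply: eq_trans (lim_seriesZ (s `^ m) (cg [::] p Pp)).
  congr (limn (series _)); apply/funext => j.
  rewrite /g /borel_summand fiber_scale_tscale borel_term_scale //; last first.
    by rewrite /punctured1 /preimage /= fproj_tscale.
  by rewrite mulrCA.
- move=> i p Pp.
  have P0 : punctured1 (slice 0 p) by rewrite /punctured1 /preimage /= fproj_slice.
  rewrite /tcoef (dw_ssum _ oP geo) // /ssum.
  have -> : (fun j => dw (g j) (nseq i tindex) (slice 0 p)) = (fun j => if i == j then i`!%:R *
    a i p else 0).
    by apply/funext => j; rewrite /g dw_borel_summand_slice0.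
  have H j : (i < j)%N -> series (fun j => if i == j then i`!%:R * a i p else 0) j = i`!%:R * a
    i p.
    move=> ij; rewrite /series /= big_mkord (bigD1 (Ordinal ij)) //= eqxx big1 ?addr0 // => k ki.
    by rewrite ifN //; apply: contraNneq ki => ik; apply/eqP/val_inj.
  rewrite (_ : limn _ = i`!%:R * a i p); last first.
    apply: lim_near_cst => //; near=> j; apply: H; near: j; exact: nbhs_infty_gt.
  by rewrite mulrA mulVf ?mul1r // pnatr_eq0 -lt0n fact_gt0.
(* Since l j >= 1, rescaling t only enlarges the region where a term vanishes, so all terms vanish
   together. *)
- move=> p Pp tp; rewrite /ssum (_ : (fun k => g k p) = fun=> 0).
    rewrite (_ : series _ = fun=> 0) ?lim_cst //.
    by apply/funext => j; rewrite /series /= big1.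
  apply/funext => j; rewrite /g /borel_summand /borel_term tcoord_tscale /sq fproj_tscale.
  rewrite smooth_step0 ?mulr0 // ler_pdivlMr ?sqnorm_gt0 // (le_trans tp) // exprMn.
  by rewrite ler_peMl ?sqr_ge0 // exprn_ege1.
Unshelve. all: by end_near. Qed.

End Borel.

(** * Proof of the equivalence *)

Section Extension.
Context {R : realType} {n d : nat}.
Local Notation V := ('rV[R]_n * 'rV[R]_d)%type.
Local Notation W := ('rV[R]_n * 'rV[R]_(d + 1))%type.

Lemma dbound_support k (s : nat -> R) (f : 'rV[R]_n * 'rV[R]_k -> R) (r : R) :
  smooth setT f -> (forall p, r < `|p.2| -> f p = 0) -> dbound s f.
Proof.
move=> sf f0; apply: (@dbound_outside _ _ _ _ _ r sf) => K ws cK; exists 1 => //.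
move=> x w Kx rw; rewrite (@dw_ext _ _ _ [set p | r < `|p.2|] _ (fun=> 0)) //.
- by rewrite dw0 normr0 mul1r powR_ge0.
- exact: open_norm_snd_gt.
Qed.

Lemma rapidZ k c (f : 'rV[R]_n * 'rV[R]_k -> R) : smooth setT f -> rapid f ->
  rapid (fun p => c * f p).
Proof.
move=> sf rf N K ws cK; have [C C0 HC] := rf N K ws cK.
exists (`|c| * C + 1); first by rewrite ltr_wpDl // mulr_ge0 // ltW.
move=> x w Kx; rewrite (dwZ _ _ openT) // normrM mulrDl ler_wpDr ?mul1r ?powR_ge0 //.
by rewrite -mulrA ler_wpM2l // HC.
Qed.

Lemma powR_le_scale (y y' c : R) (N : nat) : 0 < y -> 0 < c -> y' <= c * y ->
  0 < y' -> y `^ (- N%:R) <= c ^+ N * y' `^ (- N%:R).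
Proof.
move=> y0 c0 yy y'0; have cy : 0 < c * y by rewrite mulr_gt0.
have := powRN_le N y'0 yy; rewrite powRM ?(ltW c0) ?(ltW y0) // (powRN c) powR_mulrn ?(ltW c0)
  // => H.
by rewrite -ler_pdivrMl ?exprn_gt0.
Qed.

Lemma rapid_fiber_scale k s (f : 'rV[R]_n * 'rV[R]_k -> R) : 0 < s -> smooth setT f ->
  rapid f -> rapid (fun p => f (fiber_scale s p)).
Proof.
move=> s0 sf rf N K ws cK; have [C C0 HC] := rf N K ws cK.
(* The constant comes from 1 + |w| <= (1 + 1/s) (1 + s |w|). *)
have c0 : 0 < 1 + s^-1 by rewrite addr_gt0 // invr_gt0.
exists (s ^+ fiber_order ws * (C * (1 + s^-1) ^+ N)).
  by rewrite !mulr_gt0 // exprn_gt0.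
move=> x w Kx; rewrite (dw_fiber_scale _ openT) // normrM ger0_norm ?exprn_ge0 ?(ltW s0) //.
rewrite -!mulrA ler_wpM2l ?exprn_ge0 ?(ltW s0) // (le_trans (HC x _ Kx)) //.
rewrite ler_wpM2l ?(ltW C0) //= normrZ ger0_norm ?(ltW s0) //.
apply: powR_le_scale => //; try by rewrite ltr_wpDr ?mulr_ge0 ?(ltW s0).
rewrite mulrDl mul1r mulrDr mulr1 mulrA mulVf ?gt_eqF // mul1r addrACA.
by rewrite lerD // ?lerDl ?lerDr ?invr_ge0 ?mulr_ge0 ?(ltW s0).
Qed.

Lemma iter_D1_bounded (h : R -> R) k : smooth setT h -> (forall t : R, 2 < t ^+ 2 -> h t = 0) ->
  exists2 C : R, 0 < C & forall t : R, (2 < `|t| -> iter k D1 h t = 0) /\ `|iter k D1 h t| <= C.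
Proof.
move=> sh h0; have z (t : R) : 2 < t ^+ 2 -> iter k D1 h t = 0.
  pose O : set R := (fun t => t ^+ 2) @^-1` [set y | 2 < y].
  have oO : open O.
    apply: open_comp; last exact: open_gt.
    by move=> x _; exact: exprn_continuous.
  move=> Ot; elim: k t Ot => [//|k IH] t Ot.
  by rewrite iterS /D1 (@derive_open_ext _ _ O _ (fun=> 0)) // derive_cst.
have [C C0 HC] := compact_bounded_fun (@segment_compact R (-2) 2)
  (fun t _ => smooth_continuous (smooth_iter_derive k sh) (Logic.I : setT t)).
have two (t : R) : 2 < `|t| -> 2 < t ^+ 2.
  move=> t2; rewrite -real_normK ?num_real // expr2 (lt_trans t2) // ltr_pMl ?(lt_trans _ t2) //.
  by rewrite ltr1n.
exists C => // t; split; first by move=> /two/z.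
have [t2|t2] := leP `|t| 2; first by apply: HC; rewrite /= in_itv /= -ler_norml.
by rewrite z ?normr0 ?(ltW C0) //; exact: two.
Qed.

(** For |t| > 2 all derivatives of h vanish; for |t| <= 2 one has 1 + |(xi, t)| <= 3 (1 + |xi|), so
    decay in xi is decay in (xi, t). *)
Lemma rapid_tensor (r : V -> R) (h : R -> R) : smooth setT r -> rapid r ->
  smooth setT h -> (forall t : R, 2 < t ^+ 2 -> h t = 0) ->
  rapid (fun p : W => r (fproj p) * h (tcoord p)).
Proof.
move=> sr rr sh h0 N K ws cK.
have [C C0 HC] := rr N K (base_word ws) cK.
have [D D0 HD] := iter_D1_bounded (torder ws) sh h0.
exists (C * D * 3 ^+ N); first by rewrite !mulr_gt0 // exprn_gt0.
move=> x w Kx; rewrite (dw_tensor _ openT) //.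
set t := tcoord _; have [z Ht] := HD t.
have [t2|/z ->] := leP `|t| 2; last first.
  by rewrite mulr0 normr0 !mulr_ge0 ?powR_ge0 ?exprn_ge0 // ltW.
rewrite normrM -[C * D * _]mulrA -[leRHS]mulrA [_ * _ * (_ `^ _)]mulrAC -[D * _ * _]mulrA
  (mulrCA C) mulrC ler_pM //.
rewrite (le_trans (HC x (lsubmx w) Kx)) // ler_wpM2l ?(ltW C0) // mulrC.
apply: powR_le_scale => //; try by rewrite ltr_wpDr.
have : `|w| <= `|lsubmx w| + 2.
  apply: (@norm_fiber_le R n d (x, w)); first by rewrite lerDl.
  by rewrite (le_trans t2) // lerDr.
move=> H; rewrite mulrDr mulr1 (le_trans (_ : _ <= 1 + (`|lsubmx w| + 2))) ?lerD2l //.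
by have := normr_ge0 (lsubmx w); move: `|lsubmx w| => y; clear; lra.
Qed.

(** The expansion is assumed for the cutoff [bump] because the same function cuts off the Borel sum:
    the two expansions can then be subtracted term by term. *)
Lemma homogeneous_extension m (a : V -> R) (aj : nat -> V -> R) :
  smooth setT a -> (forall j, smooth punctured (aj j)) ->
  (forall j p (s : R), 0 < s -> punctured p -> aj j (fiber_scale s p) = s `^ (m - j%:R) * aj j
    p) ->
  (forall N, dbound (fun k => m - N%:R - 1 - k%:R)
     (fun p => a p - \sum_(j < N.+1) bump p.2 * aj j p)) ->
  exists u : W -> R, [/\ smooth setT u,
    forall s : R, 0 < s -> rapid (fun p => u (fiber_scale s p) - s `^ m * u p) &
    forall p, u (slice 1 p) = a p].
Proof.
move=> sa saj haj Hexp.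
have [v [sv hv vj v0]] := borel saj haj.
have r0 : 0 < d.+1%:R^-1 :> R by rewrite invr_gt0.
have sbump := @smooth_bump R d.
pose b (p : W) := bump (fproj p).2 * v p.
have sb : smooth setT b.
  have sbf : smooth setT (fun p : W => bump (fproj p).2).
    apply: (@smooth_comp_linear R n (d + 1) _ (fproj : {linear W -> V}) setT setT (fun p : V =>
      bump p.2)) => //.
      exact: openT.
    by apply: (@smooth_comp_linear R n d _ (snd : {linear V -> 'rV[R]_d}) setT setT) => //;
      exact: openT.
  move=> k; have -> : [set: W] = punctured1 `|` (fproj @^-1` [set p : V | `|p.2| < d.+1%:R^-1]).
    apply/seteqP; split=> // p _; have [p0|p0] := eqVneq (fproj p).2 0; last by left.
    by right; rewrite /preimage /mkset p0 normr0.
  apply: Ck_onU.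
    apply: Ck_onM; [exact: open_punctured1| |exact: sv].
    exact: (smooth_sub _ sbf).
  apply: (Ck_on_ext (f := fun=> 0)); last exact: Ck_on_cst.
    by apply: open_fproj; exact: open_norm_snd_lt.
  by move=> q /bump0; rewrite /b => ->; rewrite mul0r.
have hb s : 0 < s -> rapid (fun p => b (fiber_scale s p) - s `^ m * b p).
  move=> s0 N.
  (* When sqnorm xi > B, the cutoff is 1 at both xi and s xi, and the defect vanishes. Otherwise,
     unless v = 0, t^2 < 2 sqnorm xi <= 2 B, so that both |xi| and |t| are at most 2 B + 1. *)
  pose B : R := 2 + 2 / s ^+ 2.
  have B0 : 0 <= B by rewrite addr_ge0 // mulr_ge0 // invr_ge0 sqr_ge0.
  apply: (@dbound_support _ _ _ (2 * B + 1)).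
    apply: smoothB; [exact: openT|exact: smooth_fiber_scale|].
    by apply: smoothZ; first exact: openT.
  have fps p : (fproj (fiber_scale s p)).2 = s *: (fproj p).2 by rewrite fproj_fiber_scale.
  move=> p; have [p0|p0] := eqVneq (fproj p).2 0.
    by rewrite /b fps p0 scaler0 bump0 ?normr0 // !mul0r mulr0 subr0.
  have Pp : punctured1 p by [].
  rewrite /b hv // fps; move=> big.
  have [tb|tb] := leP (2 * sqnorm (fproj p).2) (tcoord p ^+ 2).
    by rewrite v0 // !mulr0 subr0.
  have sqB : B < sqnorm (fproj p).2.
    rewrite ltNge; apply: contraTN big => sqB; rewrite -leNgt.
    have small (y : R) : y ^+ 2 <= 2 * B -> `|y| <= 2 * B + 1.
      move=> yB; have [y1|y1] := leP `|y| 1.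
        by rewrite (le_trans y1) // lerDr mulr_ge0.
      rewrite ler_wpDr // (le_trans _ yB) // -real_normK ?num_real // expr2.
      by rewrite ler_peMl // ltW.
    apply: norm_fiber_le.
      rewrite -[leLHS]normr_id; apply: small.
      by rewrite (le_trans (norm_sqr_le_sqnorm _)) // (le_trans sqB) // ler_peMl // ler1n.
    by apply: small; rewrite (le_trans (ltW tb)) // ler_wpM2l.
  have b1 : bump (fproj p).2 = 1.
    rewrite /bump smooth_step0 ?subr0 // ltW // (le_lt_trans _ sqB) // lerDl.
    by rewrite mulr_ge0 // invr_ge0 sqr_ge0.
  have b2 : bump (s *: (fproj p).2) = 1.
    rewrite /bump smooth_step0 ?subr0 // sqnormZ mulrC -ler_pdivrMr ?exprn_gt0 // ltW //.
    by rewrite (le_lt_trans _ sqB) // lerDr.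
  by rewrite b1 b2 !mul1r subrr.
have sbs : smooth setT (b \o slice 1).
  move=> k; have := @Ck_on_affine R _ _ k setT setT b (slice 0 : {linear V -> W}) (slice 1 0).
  move=> H; apply: Ck_on_ext (H _ _ (sb k)) => //; first exact: openT.
    by move=> q _ /=; rewrite -sliceE.
  exact: continuous_linear.
pose r p := a p - b (slice 1 p).
have sr : smooth setT r by apply: smoothB => //; exact: openT.
have saj' j : smooth setT (fun p : V => bump p.2 * aj j p).
  apply: (smooth_cutoff_mul (U := punctured) r0) => //; first exact: open_punctured.
  exact: bump0.
have rr : rapid r.
  (* Both expansions, taken up to index N, leave remainders of order m - N - 1 <= - M. *)
  move=> M; have [N HN] := nat_gt (m + M%:R).
  have H1 := Hexp N.
  have H2 : dbound (fun k => m - N.+1%:R - k%:R)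
      (fun p => b (slice 1 p) - \sum_(j < N.+1) bump p.2 * tcoef v j p).
    apply: (expansion_symbol (r1 := 2) _ sv hv sbs r0) => //; [exact: bump0|exact: bump1|].
    (* Beyond radius 2 the slices of b and v coincide: the error is 0 and any positive constant will
       do. *)
    move=> K ws M' cK; exists 1 => // x xi Kx xi2.
    rewrite (@dw_ext _ _ _ [set p : V | 2 < `|p.2|] _ (fun=> 0)) //.
    - by rewrite dw0 normr0 mul1r powR_ge0.
    - exact: open_norm_snd_gt.
    - by move=> q /bump1 q2; rewrite /comp /b fproj_slice q2 mul1r subrr.
  have E : (fun p => b (slice 1 p) - \sum_(j < N.+1) bump p.2 * tcoef v j p) =
     (fun p => b (slice 1 p) - \sum_(j < N.+1) bump p.2 * aj j p).
    (* At xi = 0 the values of [aj] and of [tcoef v] are unrelated; the cutoff removes them. *)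
    apply/funext => p; congr (_ - _); apply: eq_bigr => j _.
    have [p0|p0] := eqVneq p.2 0; last by rewrite vj.
    by rewrite p0 bump0 ?mul0r // normr0.
  rewrite {}E in H2.
  have -> : r = (fun p => (a p - \sum_(j < N.+1) bump p.2 * aj j p) -
      (b (slice 1 p) - \sum_(j < N.+1) bump p.2 * aj j p)).
    by apply/funext => p; rewrite /r opprB addrA subrK.
  have sS : smooth setT (fun p : V => \sum_(j < N.+1) bump p.2 * aj j p).
    by apply: smooth_sum => //; exact: openT.
  apply: dboundB; [by apply: smoothB => //; exact: openT|by apply: smoothB => //; exact: openT|
    |].
    apply: dbound_le H1 => k; rewrite -subr_ge0.
    have -> : - M%:R - (m - N%:R - 1 - k%:R) = (N%:R - (m + M%:R)) + 1 + k%:R :> R by ring.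
    by rewrite addr_ge0 // addr_ge0 // subr_ge0.
  apply: dbound_le H2 => k; rewrite -subr_ge0 -natr1.
  have -> : - M%:R - (m - (N%:R + 1) - k%:R) = (N%:R - (m + M%:R)) + 1 + k%:R :> R by ring.
  by rewrite addr_ge0 // addr_ge0 // subr_ge0.
pose h (t : R) := smooth_step (t ^+ 2).
have sh : smooth setT h.
  apply: (smooth_comp1 openT smooth_smooth_step) => k; apply: Ck_onX; first exact: openT.
  by apply: (@Ck_on_linear _ _ k setT (idfun : {linear R -> R})) => x; exact: cvg_id.
have h0 (t : R) : 2 < t ^+ 2 -> h t = 0 by move=> t2; rewrite /h smooth_step0 // ltW.
pose rt (p : W) := r (fproj p) * h (tcoord p).
have srt : smooth setT rt.
  apply: smoothM; [exact: openT| |].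
    by apply: (@smooth_comp_linear R n (d + 1) _ (fproj : {linear W -> V}) setT setT) => //;
      exact: openT.
  by apply: (@smooth_comp_linear R n (d + 1) _ (tcoord : {linear W -> R}) setT setT) => //;
    exact: openT.
have rrt : rapid rt by exact: rapid_tensor.
exists (fun p => b p + rt p); split.
- by apply: smoothD => //; exact: openT.
- move=> s s0 N.
  have -> : (fun p => b (fiber_scale s p) + rt (fiber_scale s p) - s `^ m * (b p + rt p)) =
    (fun p => (b (fiber_scale s p) - s `^ m * b p) + (rt (fiber_scale s p) - s `^ m * rt p)).
    by apply/funext => p; rewrite mulrDr opprD addrACA.
  have sZ f : smooth (setT : set W) f -> smooth (setT : set W) (fun p => s `^ m * f p).
    by move=> sf; apply: smoothZ => //; exact: openT.
  have sF (f : W -> R) : smooth setT f -> smooth setT (fun p => f (fiber_scale s p)).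
    exact: smooth_fiber_scale.
  have sFZ f : smooth (setT : set W) f -> smooth (setT : set W) (fun p => f (fiber_scale s p) -
    s `^ m * f p).
    by move=> sf; apply: smoothB; [exact: openT|exact: sF|exact: sZ].
  apply: dboundD; [exact: sFZ|exact: sFZ|exact: hb|].
  apply: dboundB; [exact: sF|exact: sZ|exact: rapid_fiber_scale|exact: rapidZ].
- move=> p; rewrite /rt fproj_slice tcoord_slice /h smooth_step1 ?expr1n // mulr1.
  by rewrite /r addrC subrK.
Qed.

End Extension.

Section ComplexParts.
Context {R : realType}.

Lemma Re_realM (c : R) (z : R[i]) : complex.Re (c%:C%C * z) = c * complex.Re z.
Proof. by case: z => x y /=; rewrite mul0r subr0. Qed.

Lemma Im_realM (c : R) (z : R[i]) : complex.Im (c%:C%C * z) = c * complex.Im z.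
Proof. by case: z => x y /=; rewrite mul0r addr0. Qed.

Lemma ReB (z w : R[i]) : complex.Re (z - w) = complex.Re z - complex.Re w.
Proof. by case: z w => [x y] [x' y']. Qed.

Lemma ImB (z w : R[i]) : complex.Im (z - w) = complex.Im z - complex.Im w.
Proof. by case: z w => [x y] [x' y']. Qed.

Lemma Re_sum (I : Type) (r : seq I) (F : I -> R[i]) :
  complex.Re (\sum_(i <- r) F i) = \sum_(i <- r) complex.Re (F i).
Proof.
elim: r => [|i r IH]; first by rewrite !big_nil.
by rewrite !big_cons -IH; case: (F i) (\sum_(j <- r) F j) => [x y] [x' y'].
Qed.

Lemma Im_sum (I : Type) (r : seq I) (F : I -> R[i]) :
  complex.Im (\sum_(i <- r) F i) = \sum_(i <- r) complex.Im (F i).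
Proof.
elim: r => [|i r IH]; first by rewrite !big_nil.
by rewrite !big_cons -IH; case: (F i) (\sum_(j <- r) F j) => [x y] [x' y'].
Qed.

Lemma ReM (z w : R[i]) : complex.Re (z * w) =
  complex.Re z * complex.Re w - complex.Im z * complex.Im w.
Proof. by case: z w => [x y] [x' y']. Qed.

Lemma ImM (z w : R[i]) : complex.Im (z * w) =
  complex.Re z * complex.Im w + complex.Im z * complex.Re w.
Proof. by case: z w => [x y] [x' y']. Qed.

Lemma complex_cutoff d : cutoff (fun xi : 'rV[R]_d => (bump xi)%:C%C).
Proof.
have r0 : 0 < d.+1%:R^-1 :> R by rewrite invr_gt0.
have r20 : 0 < d.+1%:R^-1 / 2 :> R by rewrite divr_gt0.
split.
- apply/smooth_onE; split; first exact: smooth_bump.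
  by move=> k; exact: Ck_on_cst.
- exists [set xi | `|xi| <= d.+1%:R^-1 / 2]; split.
  + by apply: (@compact_row_ball R d (d.+1%:R^-1 / 2)) => //; exact: closed_norm_le.
  + have : nbhs (0 : 'rV[R]_d) (ball (0 : 'rV[R]_d) (d.+1%:R^-1 / 2)) by exact: nbhsx_ballx.
    by apply: filterS => xi; rewrite -ball_normE /ball_ /= sub0r normrN => /ltW.
  + by move=> xi /= H; rewrite bump0 // (le_lt_trans H) // ltr_pdivrMr // ltr_pMr // ltr1n.
- exists [set xi | `|xi| <= 2]; split.
    by apply: (@compact_row_ball R d 2) => //; exact: closed_norm_le.
  by move=> xi /= /negP; rewrite -ltNge => /bump1 ->.
Qed.

Lemma cutoff_radii d (chi : 'rV[R]_d -> R[i]) : cutoff chi ->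
  [/\ smooth setT (re_part chi), smooth setT (im_part chi) &
   exists r0 r1 : R, [/\ 0 < r0,
     forall xi, `|xi| < r0 -> chi xi = 0 & forall xi, r1 < `|xi| -> chi xi = 1]].
Proof.
move=> [/smooth_onE[s1 s2] [K0 [_ /nbhs_ballP[r0 /= r00 HK0] chi0]] [K1 [cK1 chi1]]].
split=> //; have [r1 [_ Hr1]] := compact_bounded cK1.
exists r0, (r1 + 1); split=> // xi.
  by move=> xir; apply: chi0; apply: HK0; rewrite -ball_normE /ball_ /= sub0r normrN.
move=> xir; apply: chi1 => K1xi; have := Hr1 (r1 + 1); rewrite ltrDl ltr01 => /(_ isT xi K1xi).
by rewrite /= leNgt xir.
Qed.

End ComplexParts.

Section Main.
Context {R : realType} {n d : nat}.
Local Notation V := ('rV[R]_n * 'rV[R]_d)%type.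
Local Notation W := ('rV[R]_n * 'rV[R]_(d + 1))%type.

(** With the real cutoff [bump] and the real factors s^(m-j), the expansion and the homogeneity
    split into real and imaginary parts, which are extended separately. *)
Lemma polyhomogeneous_extension (m : R) (a : V -> R[i]) :
  smooth_on setT a -> polyhomogeneous m a ->
  exists2 u : W -> R[i], homogeneous_mod_schwartz m u &
    forall x xi, u (x, fiber_pt xi 1) = a (x, xi).
Proof.
move=> /smooth_onE[s1 s2] [_ [aj [saj haj Hexp]]].
have sj1 j : smooth punctured (re_part (aj j)) by have [] := (smooth_onE _ _).1 (saj j).
have sj2 j : smooth punctured (im_part (aj j)) by have [] := (smooth_onE _ _).1 (saj j).
have hj j (p : V) (s : R) : 0 < s -> punctured p ->
    aj j (fiber_scale s p) = (s `^ (m - j%:R))%:C%C * aj j p.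
  by case: p => x xi s0 Pp; exact: haj.
have [u1 [su1 hu1 u1a]] : exists u : W -> R, [/\ smooth setT u,
    forall s : R, 0 < s -> rapid (fun p => u (fiber_scale s p) - s `^ m * u p) &
    forall p, u (slice 1 p) = re_part a p].
  apply: (@homogeneous_extension R n d m (re_part a) (fun j => re_part (aj j))) => //.
    by move=> j p s s0 Pp; rewrite /re_part hj // Re_realM.
  move=> N; have [_ + _] := (symbolE _ _).1 (Hexp N _ (complex_cutoff d)).
  congr (dbound _ _); apply/funext => p; rewrite /re_part ReB Re_sum; congr (_ - _).
  by apply: eq_bigr => j _; rewrite Re_realM.
have [u2 [su2 hu2 u2a]] : exists u : W -> R, [/\ smooth setT u,
    forall s : R, 0 < s -> rapid (fun p => u (fiber_scale s p) - s `^ m * u p) &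
    forall p, u (slice 1 p) = im_part a p].
  apply: (@homogeneous_extension R n d m (im_part a) (fun j => im_part (aj j))) => //.
    by move=> j p s s0 Pp; rewrite /im_part hj // Im_realM.
  move=> N; have [_ _ +] := (symbolE _ _).1 (Hexp N _ (complex_cutoff d)).
  congr (dbound _ _); apply/funext => p; rewrite /im_part ImB Im_sum; congr (_ - _).
  by apply: eq_bigr => j _; rewrite Im_realM.
exists (fun p => (u1 p +i* u2 p)%C); last first.
  move=> x xi; rewrite -[fiber_pt xi 1]/(slice 1 (x, xi)).2 -[(x, _)]/(slice 1 (x, xi)).
  by rewrite u1a u2a /re_part /im_part; case: (a _).
split; first by apply/smooth_onE.
move=> s s0; apply/schwartzE.
have E1 : re_part (fun p : W => (u1 (p.1, s *: p.2) +i* u2 (p.1, s *: p.2))%C - (s `^ m)%:C%C *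
  (u1 p +i* u2 p)%C)
   = (fun p => u1 (fiber_scale s p) - s `^ m * u1 p).
  by apply/funext => p; rewrite /re_part ReB Re_realM.
have E2 : im_part (fun p : W => (u1 (p.1, s *: p.2) +i* u2 (p.1, s *: p.2))%C - (s `^ m)%:C%C *
  (u1 p +i* u2 p)%C)
   = (fun p => u2 (fiber_scale s p) - s `^ m * u2 p).
  by apply/funext => p; rewrite /im_part ImB Im_realM.
have sm (f : W -> R) : smooth setT f -> smooth setT (fun p => f (fiber_scale s p) - s `^ m * f p).
  move=> sf; apply: smoothB; [exact: openT|exact: smooth_fiber_scale|].
  by apply: smoothZ; first exact: openT.
split; first by apply/smooth_onE; rewrite E1 E2; split; exact: sm.
- by rewrite E1; exact: hu1.
- by rewrite E2; exact: hu2.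
Qed.

Lemma extension_polyhomogeneous (m : R) (a : V -> R[i]) (u : W -> R[i]) :
  smooth_on setT a -> homogeneous_mod_schwartz m u ->
  (forall x xi, u (x, fiber_pt xi 1) = a (x, xi)) -> polyhomogeneous m a.
Proof.
move=> sa [su hu] ua; have /smooth_onE[s1 s2] := sa; have /smooth_onE[su1 su2] := su.
have hu1 (s : R) : 0 < s -> rapid (fun p => re_part u (fiber_scale s p) - s `^ m * re_part u p).
  move=> /hu /schwartzE[_ + _]; congr (rapid _); apply/funext => p.
  by rewrite /re_part ReB Re_realM.
have hu2 (s : R) : 0 < s -> rapid (fun p => im_part u (fiber_scale s p) - s `^ m * im_part u p).
  move=> /hu /schwartzE[_ _]; congr (rapid _); apply/funext => p.
  by rewrite /im_part ImB Im_realM.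
have a1 p : re_part a p = re_part u (slice 1 p) by case: p => x xi; rewrite /re_part -ua.
have a2 p : im_part a p = im_part u (slice 1 p) by case: p => x xi; rewrite /im_part -ua.
have [v1 [sv1 hv1 Hv1]] := homogeneous_limit su1 hu1.
have [v2 [sv2 hv2 Hv2]] := homogeneous_limit su2 hu2.
rewrite -(funext a1) in Hv1; rewrite -(funext a2) in Hv2.
(* N = 0, the empty expansion, is the symbol estimate for f itself. *)
have expand (v : W -> R) (f : V -> R) (chi : 'rV[R]_d -> R) (r0 r1 : R) N :
    smooth setT f -> smooth punctured1 v -> homogeneous m v ->
    slice_approx 1 f v ->
    0 < r0 -> smooth setT chi -> (forall xi, `|xi| < r0 -> chi xi = 0) ->
    (forall xi, r1 < `|xi| -> chi xi = 1) ->
    dbound (fun k => m - N%:R - k%:R) (fun p => f p - \sum_(j < N) chi p.2 * tcoef v j p).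
  move=> sf sv hv Hv r00 schi chi0 chi1.
  apply: (expansion_symbol (r1 := Num.max r1 1) _ sv hv sf r00) => //.
    by move=> xi; rewrite gt_max => /andP[/chi1].
  by apply: slice_approx_le Hv; rewrite le_max lexx orbT.
have r0 : 0 < d.+1%:R^-1 :> R by rewrite invr_gt0.
split.
  have E (v : W -> R) (f : V -> R) : (fun p => f p - \sum_(j < 0) bump p.2 * tcoef v j p) = f.
    by apply/funext => p; rewrite big_ord0 subr0.
  apply/symbolE; split=> //.
    have := expand v1 (re_part a) (@bump R d) _ 2 0%N s1 sv1 hv1 Hv1 r0 (@smooth_bump R d)
      (@bump0 R d) (@bump1 R d).
    by rewrite E; apply: dbound_le => k; rewrite subr0.
  have := expand v2 (im_part a) (@bump R d) _ 2 0%N s2 sv2 hv2 Hv2 r0 (@smooth_bump R d) (@bump0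
    R d) (@bump1 R d).
  by rewrite E; apply: dbound_le => k; rewrite subr0.
exists (fun j p => (tcoef v1 j p +i* tcoef v2 j p)%C); split.
- by move=> j; apply/smooth_onE; split; exact: smooth_tcoef.
- move=> j x xi s s0 xi0.
  have Pp : punctured (x, xi) by [].
  have H v : smooth punctured1 v -> homogeneous m v ->
      tcoef v j (fiber_scale s (x, xi)) = s `^ (m - j%:R) * tcoef v j (x, xi).
    move=> sv hv; rewrite /tcoef -[in LHS](mulr0 s) -fiber_scale_slice.
    rewrite (dw_homogeneous (nseq j tindex) sv hv) //; last first.
      by rewrite /punctured1 /preimage /= fproj_slice.
    by rewrite mulrCA /fiber_order count_nseq mul1n.
  rewrite -[(x, s *: xi)]/(fiber_scale s (x, xi)) !H //.
  by apply/eqP; rewrite eq_complex /= !mul0r subr0 addr0 !eqxx.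
move=> N chi /cutoff_radii[sc1 sc2 [r [r1 [r00 chi0 chi1]]]].
have c1_0 xi : `|xi| < r -> re_part chi xi = 0 by move=> /chi0 E; rewrite /re_part E.
have c2_0 xi : `|xi| < r -> im_part chi xi = 0 by move=> /chi0 E; rewrite /im_part E.
have c1_1 xi : r1 < `|xi| -> re_part chi xi = 1 by move=> /chi1 E; rewrite /re_part E.
have c2_1 xi : r1 < `|xi| -> im_part chi xi = 0 by move=> /chi1 E; rewrite /im_part E.
pose S (c : 'rV[R]_d -> R) (v : W -> R) (p : V) := \sum_(j < N.+1) c p.2 * tcoef v j p.
have sS (c : 'rV[R]_d -> R) v : smooth setT c -> (forall xi, `|xi| < r -> c xi = 0) ->
    smooth punctured1 v -> smooth setT (S c v).
  move=> sc c0 sv; apply: smooth_sum => [|j]; first exact: openT.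
  apply: (smooth_cutoff_mul (U := punctured) r00) => //; first exact: open_punctured.
  exact: smooth_tcoef.
(* Im chi vanishes near xi = 0 and for |xi| > r1, so its products with the Taylor coefficients
   satisfy bounds of every order. *)
have bS v : smooth punctured1 v -> dbound (fun k => m - N%:R - 1 - k%:R) (S (im_part chi) v).
  move=> sv; apply: (@dbound_support R n d _ _ r1); first exact: sS.
  by move=> p p1; rewrite /S big1 // => j _; rewrite c2_1 ?mul0r.
(* [expand] counts the terms, whereas polyhomogeneity names the last index N: N + 1 terms leave
   order m - N - 1. *)
have sub1 k : m - N.+1%:R - k%:R <= m - N%:R - 1 - k%:R by rewrite -natr1 opprD addrA.
have B (v : W -> R) (f : V -> R) (sf : smooth setT f) sv hv Hv :=
  dbound_le sub1 (expand v f (re_part chi) r r1 N.+1 sf sv hv Hv r00 sc1 c1_0 c1_1).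
have sB (f : V -> R) v c : smooth setT f -> smooth setT c -> (forall xi, `|xi| < r -> c xi = 0) ->
    smooth punctured1 v -> smooth setT (fun p => f p - S c v p).
  by move=> sf sc c0 sv; apply: smoothB => //; [exact: openT|exact: sS].
have E1 : re_part (fun p => a p - \sum_(j < N.+1) chi p.2 * (tcoef v1 j p +i* tcoef v2 j p)%C) =
    (fun p => (re_part a p - S (re_part chi) v1 p) + S (im_part chi) v2 p).
  apply/funext => p; rewrite /re_part ReB Re_sum -addrA; congr (_ + _).
  rewrite (eq_bigr (fun j : 'I_N.+1 => complex.Re (chi p.2) * tcoef v1 j p -
    complex.Im (chi p.2) * tcoef v2 j p)) => [|j _]; last by rewrite ReM.
  by rewrite sumrB opprB addrC.
have E2 : im_part (fun p => a p - \sum_(j < N.+1) chi p.2 * (tcoef v1 j p +i* tcoef v2 j p)%C) =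
    (fun p => (im_part a p - S (re_part chi) v2 p) - S (im_part chi) v1 p).
  apply/funext => p; rewrite /im_part ImB Im_sum -addrA; congr (_ + _).
  rewrite (eq_bigr (fun j : 'I_N.+1 => complex.Re (chi p.2) * tcoef v2 j p +
    complex.Im (chi p.2) * tcoef v1 j p)) => [|j _]; last by rewrite ImM.
  by rewrite big_split opprD.
apply/symbolE; rewrite E1 E2; split.
- apply/smooth_onE; rewrite E1 E2; split.
    by apply: smoothD; [exact: openT|exact: sB|exact: sS].
  by apply: smoothB; [exact: openT|exact: sB|exact: sS].
- apply: dboundD; [exact: sB|exact: sS|exact: B|exact: bS].
- apply: dboundB; [exact: sB|exact: sS|exact: B|exact: bS].
Qed.

End Main.

Theorem theorem1p2 (R : realType) (n d : nat) (m : R)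
    (a : 'rV[R]_n * 'rV[R]_d -> R[i]) (ha : smooth_on setT a) :
  polyhomogeneous m a <->
  exists2 u : 'rV[R]_n * 'rV[R]_(d + 1) -> R[i],
    homogeneous_mod_schwartz m u &
    forall (x : 'rV[R]_n) (xi : 'rV[R]_d), u (x, fiber_pt xi 1) = a (x, xi).
Proof.
split; first exact: polyhomogeneous_extension.
by move=> [u hu ua]; exact: extension_polyhomogeneous hu ua.
Qed.
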